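(* Let $\widetilde{T}\in\mathbb{N}$ with $\widetilde T\ge 2$, let $k=\lceil 24\log(\widetilde{T}^2)\rceil$ and let the time horizon be $T=4k\widetilde T$. Consider the qubit pure-state multi-armed quantum bandit with action set $\mathcal{S}_2^*$ and an unknown environment $|\psi\rangle\!\langle\psi|\in\mathcal{S}_2^*$. Run the algorithm LinUCB-VVN (described in the context) with $d=3$, $\lambda_0=2$ and $k$ subsamples on the Bloch-vector representation of the problem, i.e. the action $A_t\in\mathbb{S}^2$ chosen by LinUCB-VVN is played as the projector $\Pi_{A_t}=\frac{1}{2}(\mathbb{I}+A_t\cdot\sigma)$ and the observed reward $X_t\in\{0,1\}$ is fed to the algorithm as $2X_t-1$. Then the resulting policy $\pi$ satisfies $$\mathbb{E}_{\psi,\pi}\big[R_T(\mathcal{S}_2^*,\psi,\pi)\big]\le C_1\log(T)+C_2\log^2(T)$$ for universal constants $C_1,C_2\ge 0$. Moreover, at each time step $t\in[T]$ the algorithm outputs an estimator $\hat\Pi_t\in\mathcal{S}_2^*$ (the projector whose Bloch vector is one of the actions played in the batch containing round $t$) such that $$\mathbb{E}_{\psi,\pi}\big[1-\langle\psi|\hat\Pi_t|\psi\rangle\big]\le \frac{C_3\log(T)}{t}$$ for a universal constant $C_3\ge 0$.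
   Context: $\mathcal{S}_2^*$ denotes the set of rank-one projectors (pure states) on $\mathbb{C}^2$, and $\sigma=(\sigma_x,\sigma_y,\sigma_z)$ are the Pauli matrices; every $\Pi\in\mathcal{S}_2^*$ is $\frac12(\mathbb{I}+a\cdot\sigma)$ for a unique $a\in\mathbb{S}^2$ (its Bloch vector). Pure-state multi-armed quantum bandit: in each round $t=1,\dots,T$ the learner receives a fresh copy of the unknown $|\psi\rangle$, chooses (based on all past actions and rewards) a projector $\Pi_{A_t}\in\mathcal{S}_2^*$, measures the two-outcome POVM $\{\Pi_{A_t},\mathbb{I}-\Pi_{A_t}\}$ and receives reward $X_t=1$ with probability $\langle\psi|\Pi_{A_t}|\psi\rangle$ and $X_t=0$ otherwise. The regret is $R_T(\mathcal{S}_2^*,\psi,\pi)=\sum_{t=1}^T\big(1-\langle\psi|\Pi_{A_t}|\psi\rangle\big)$, and $\mathbb{E}_{\psi,\pi}$ is expectation over the induced process. Logarithms are natural. Algorithm LinUCB-VVN (parameters: dimension $d\ge2$, $\lambda_0>0$, $k\in\mathbb{N}$, number of batches $\widetilde T$). Let $\beta_w=9(3\sqrt d+\lambda_0)^2$ and for a real positive semidefinite $d\times d$ matrix $X$ let $\omega(X)=\sqrt{\lambda_{\max}(X)}/(12\sqrt{d-1}\,\beta_w)$. Set $V_0=\lambda_0\mathbb{I}_d$ and pick an arbitrary $\hat\theta_0\in\mathbb{S}^{d-1}$. For batch $s=1,\dots,\widetilde T$: let $v_{s-1,1},\dots,v_{s-1,d}$ be orthonormal eigenvectors of $V_{s-1}$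 ordered by non-decreasing eigenvalue, $\lambda_{s-1,1}=\lambda_{\min}(V_{s-1})$, $c_{s-1}=\hat\theta_{s-1}/\|\hat\theta_{s-1}\|_2$; for $i\in[d-1]$ set $A^{\pm}_{s,i}=\tilde A^\pm_{s,i}/\|\tilde A^\pm_{s,i}\|_2$ with $\tilde A^\pm_{s,i}=c_{s-1}\pm\lambda_{s-1,1}^{-1/2}v_{s-1,i}$. Each of the $2(d-1)$ actions is played $k$ times, giving rewards $X^\pm_{s,i,j}$, $j\in[k]$ (so a batch consists of $2(d-1)k$ rounds). Let $w_1=1$ and $w_s=\omega(V_{s-1})$ for $s\ge2$; set $V_s=V_{s-1}+w_s\sum_{i=1}^{d-1}\big(A^+_{s,i}(A^+_{s,i})^{\mathsf T}+A^-_{s,i}(A^-_{s,i})^{\mathsf T}\big)$, and for $j\in[k]$, $\hat\theta_{s,j}=V_s^{-1}\sum_{r=1}^s w_r\sum_{i=1}^{d-1}\big(X^+_{r,i,j}A^+_{r,i}+X^-_{r,i,j}A^-_{r,i}\big)$. With $\|x\|_V=\sqrt{x^{\mathsf T}Vx}$, let $y_j=\mathrm{median}\{\|\hat\theta_{s,j}-\hat\theta_{s,l}\|_{V_s}:l\in[k]\setminus\{j\}\}$ and $\hat\theta_s=\hat\theta_{s,j^*}$ with $j^*\in\arg\min_j y_j$. *)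

(* Defs.v *)
From HB Require Import structures.
From mathcomp Require Import all_boot all_order all_algebra.
From mathcomp Require Import complex.
From mathcomp Require Import all_classical all_reals all_analysis.

Set Implicit Arguments.
Unset Strict Implicit.
Unset Printing Implicit Defensive.

Import Order.TTheory GRing.Theory Num.Theory.
Local Open Scope ring_scope.

Section QuantumBandit.
Variable R : realType.
Local Notation C := (R[i]).

Definition sigma_x : 'M[C]_2 :=
  \matrix_(i < 2, j < 2) (if i == j then 0 else 1).
Definition sigma_y : 'M[C]_2 :=
  \matrix_(i < 2, j < 2)
    (if i == j then 0 else if (i : nat) == 0%N then - 'i%C else 'i%C).
Definition sigma_z : 'M[C]_2 :=
  \matrix_(i < 2, j < 2)
    (if i == j then (if (i : nat) == 0%N then 1 else -1) else 0).

Definition bx (a : 'cV[R]_3) : R := a ord0 ord0.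
Definition by_ (a : 'cV[R]_3) : R := a (inord 1) ord0.
Definition bz (a : 'cV[R]_3) : R := a (inord 2) ord0.

Definition proj_of (a : 'cV[R]_3) : 'M[C]_2 :=
  (2%:R)^-1 *: (1%:M + ((bx a)%:C)%C *: sigma_x + ((by_ a)%:C)%C *: sigma_y
                     + ((bz a)%:C)%C *: sigma_z).

Definition braket (psi : 'cV[C]_2) (M : 'M[C]_2) : C :=
  ((map_mx conjc psi)^T *m M *m psi) ord0 ord0.

Definition unit_state (psi : 'cV[C]_2) : Prop := braket psi 1%:M = 1.

Definition born (psi : 'cV[C]_2) (Pi : 'M[C]_2) : R := complex.Re (braket psi Pi).

(** ** Law of the bandit process induced by a deterministic policy.
    A policy maps a round index t (0-based) and the history of past rewards
    (rewards of rounds 0..t-1, as a sequence of booleans, true = reward 1)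
    to a projector. The expectation of a functional f of the reward
    sequence over a horizon T is the finite sum over all reward sequences
    of the probability of the sequence times f. *)

Definition policy := nat -> seq bool -> 'M[C]_2.

Definition hist (T : nat) (x : {ffun 'I_T -> bool}) (t : nat) : seq bool :=
  take t (codom x).

Definition seq_prob (psi : 'cV[C]_2) (pol : policy) (T : nat)
  (x : {ffun 'I_T -> bool}) : R :=
  \prod_(t < T)
     (let p := born psi (pol t (hist x t)) in if x t then p else 1 - p).

Definition Expect (psi : 'cV[C]_2) (pol : policy) (T : nat)
  (f : {ffun 'I_T -> bool} -> R) : R :=
  \sum_(x : {ffun 'I_T -> bool}) @seq_prob psi pol T x * f x.

Definition regret (psi : 'cV[C]_2) (pol : policy) (T : nat)
  (x : {ffun 'I_T -> bool}) : R :=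
  \sum_(t < T) (1 - born psi (pol t (hist x t))).

Section LinUCB.
Variable n : nat.
Local Notation d := n.+2.

Definition vnorm (v : 'cV[R]_d) : R := Num.sqrt (\sum_i (v i ord0) ^+ 2).
Definition Vnorm (V : 'M[R]_d) (v : 'cV[R]_d) : R :=
  Num.sqrt ((v^T *m V *m v) ord0 ord0).

Definition eigval (V Q : 'M[R]_d) (i : 'I_d) : R := (Q^T *m V *m Q) i i.
Definition eig_spec (V Q : 'M[R]_d) : Prop :=
  Q^T *m Q = 1%:M /\
  (forall i : 'I_d, V *m col i Q = eigval V Q i *: col i Q) /\
  (forall i j : 'I_d, (i <= j)%N -> eigval V Q i <= eigval V Q j).

(** a median of a sequence: at least half of the entries are <= m and at
    least half are >= m (covers every usual convention for even size) *)
Definition is_median (s : seq R) (m : R) : Prop :=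
  (size s <= 2 * count (fun x : R => (x <= m)%R) s)%N /\
  (size s <= 2 * count (fun x : R => (m <= x)%R) s)%N.

Definition is_argmin (s : seq R) (j : nat) : Prop :=
  (j < size s)%N /\ forall l, (l < size s)%N -> nth 0 s j <= nth 0 s l.

Variables (lambda0 : R) (k : nat).
(** implementation choices left open by the description *)
Variable eigf : 'M[R]_d -> 'M[R]_d.
Variable med : seq R -> R.
Variable argsel : seq R -> nat.
Variable theta0 : 'cV[R]_d.

Definition beta_w : R := 9%:R * (3%:R * Num.sqrt (d%:R) + lambda0) ^+ 2.
Definition omega (X : 'M[R]_d) : R :=
  Num.sqrt (eigval X (eigf X) ord_max) /
  (12%:R * Num.sqrt ((d.-1)%:R) * beta_w).

Definition batch_len : nat := (2 * d.-1 * k)%N.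

(** 0-based round index of the j-th play of action A^{sg}_{s,i}
    (s 1-based batch, sg = true for +, false for -) *)
Definition round_of (s : nat) (i : 'I_d.-1) (sg : bool) (j : nat) : nat :=
  ((s.-1) * batch_len + (2 * i + (if sg then 0 else 1)) * k + j)%N.

Definition action (V : 'M[R]_d) (th : 'cV[R]_d) (sg : bool) (i : 'I_d.-1)
  : 'cV[R]_d :=
  let Q := eigf V in
  let lam1 := eigval V Q ord0 in
  let c := (vnorm th)^-1 *: th in
  let v := col (widen_ord (leqnSn d.-1) i) Q in
  let At := c + (if sg then 1 else -1) * (Num.sqrt lam1)^-1 *: v in
  (vnorm At)^-1 *: At.

(** state after batch s: (V_s, (fun j => sum_r w_r sum_i (X+ A+ + X- A-)),
    theta_s); rewards x : nat -> bool (round-indexed), fed as 2X-1 *)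
Fixpoint lstate (x : nat -> bool) (s : nat)
  : 'M[R]_d * (nat -> 'cV[R]_d) * 'cV[R]_d :=
  match s with
  | 0%N => (lambda0%:M, fun _ => 0, theta0)
  | s'.+1 =>
    let: (V, b, th) := lstate x s' in
    let Y r : R := 2%:R * (x r)%:R - 1 in
    let w := if s' == 0%N then 1 else omega V in
    let V' := V + w *: \sum_(i < d.-1)
                 (action V th true i *m (action V th true i)^T +
                  action V th false i *m (action V th false i)^T) in
    let b' j := b j + w *: \sum_(i < d.-1)
                 (Y (round_of s i true j) *: action V th true i +
                  Y (round_of s i false j) *: action V th false i) in
    let thj j := invmx V' *m b' j in
    let y j := med [seq Vnorm V' (thj j - thj l) | l <- iota 0 k & l != j] in
    let jstar := argsel [seq y j | j <- iota 0 k] in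
    (V', b', thj jstar)
  end.

Definition batch_action (x : nat -> bool) (s : nat) (sg : bool) (i : 'I_d.-1)
  : 'cV[R]_d :=
  let: (V, _, th) := lstate x s.-1 in action V th sg i.

Definition batch_of (t : nat) : nat := (t %/ batch_len).+1.

Definition linucb_bloch (t : nat) (h : seq bool) : 'cV[R]_d :=
  let x r := nth false h r in
  let m := (t %% batch_len)%N in
  let q := (m %/ k)%N in
  batch_action x (batch_of t) ((q %% 2)%N == 0%N) (inord (q %/ 2)%N).

End LinUCB.

Definition linucb_policy (lambda0 : R) (k : nat) (eigf : 'M[R]_3 -> 'M[R]_3)
  (med : seq R -> R) (argsel : seq R -> nat) (theta0 : 'cV[R]_3) : policy :=
  fun t h => proj_of (linucb_bloch (n:=1) lambda0 k eigf med argsel theta0 t h).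

End QuantumBandit.

(* Main.v *)
Require Import Defs.
From HB Require Import structures.
From mathcomp Require Import all_boot all_order all_algebra.
From mathcomp Require Import complex.
From mathcomp Require Import all_classical all_reals all_analysis.
From mathcomp Require Import ring lra zify.
Set Implicit Arguments.
Unset Strict Implicit.
Unset Printing Implicit Defensive.
Import Order.TTheory GRing.Theory Num.Theory.
Local Open Scope ring_scope.

(** Let [theta] be the Bloch vector of [psi]. Along every path the design matrix [V_s] has trace
    of order [s^2] and smallest eigenvalue at least [4/7] of the square root of the largest one,
    hence of order [s]. As long as the estimates stay within a constant [V]-distance of [theta],
    an action deviates from [theta] by [O(1/sqrt s)], so that weight times variance of every
    reward is bounded by a constant.

    The subsamples are not independent, since they share adaptively chosen actions, but at each
    round only one of them receives a reward. With [S_j] the weighted noise of subsample [j] and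
    [U] the Gram matrix of the noise started at a deterministic reference matrix, the product over
    [j] of [(1 + |S_j|^2_(U^-1) / K) * (det U)^(-1/N)] is therefore a supermartingale while the
    history is good. The reference matrix keeps [det U] within a constant factor, so a third of
    the [S_j] being large has probability at most [exp(-k/24) <= Tt^-2]; otherwise median of means
    yields the next good estimate. A decomposition at the first failing batch gives expected loss
    [O(1/s)] in batch [s], and the regret bound is the sum of these losses over all rounds. *)

(** * Quadratic forms *)

(** Two circles have to be broken. Estimates are good only if the earlier noise was small, and the
    noise is small only if the earlier estimates were good; so the indicator of a good past is a
    factor of the potential, and the one-step inequality is needed on good histories only. Moreover
    the radius allowed for the estimates must return as the same constant in every batch, with no
    logarithmic loss, which forces a bounded determinant growth. Hence there is one potential per
    tested batch [s], each with its own reference matrix. That matrix must be known before the first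
    reward, because the failure bound divides by the starting value of the potential. Its shape
    copies the design: the total weight after [s] batches is of order [s^2], while on a good history
    each block adds at most a constant across [theta]. So it has size [s^2] along [theta] and [s]
    across; rescaled by its inverse square root, the Gram matrix has bounded trace and, by the mean
    inequality, bounded determinant. The room for all numerical constants comes from the smallness
    of the factor [mu] in the weights. *)

Section Dot.
Variables (R : realFieldType) (n : nat).
Implicit Types (u v x y a : 'cV[R]_n) (U V : 'M[R]_n).

Definition dot u v : R := (u^T *m v) ord0 ord0.

Lemma dotE u v : dot u v = \sum_i u i ord0 * v i ord0.
Proof. by rewrite /dot mxE; apply: eq_bigr => i _; rewrite mxE. Qed.

Lemma dotC u v : dot u v = dot v u.
Proof. by rewrite !dotE; apply: eq_bigr => i _; rewrite mulrC. Qed.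

Lemma dotDl u v x : dot (u + v) x = dot u x + dot v x.
Proof. by rewrite /dot linearD mulmxDl mxE. Qed.

Lemma dotDr u v x : dot x (u + v) = dot x u + dot x v.
Proof. by rewrite /dot mulmxDr mxE. Qed.

Lemma dotZl (c : R) u v : dot (c *: u) v = c * dot u v.
Proof. by rewrite /dot linearZ -scalemxAl mxE. Qed.

Lemma dotZr (c : R) u v : dot u (c *: v) = c * dot u v.
Proof. by rewrite /dot -scalemxAr mxE. Qed.

Lemma dotNl u v : dot (- u) v = - dot u v.
Proof. by rewrite -scaleN1r dotZl mulN1r. Qed.

Lemma dotNr u v : dot u (- v) = - dot u v.
Proof. by rewrite -scaleN1r dotZr mulN1r. Qed.

Lemma dot0l v : dot 0 v = 0.
Proof. by rewrite -(scale0r 0) dotZl mul0r. Qed.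

Lemma dot0r v : dot v 0 = 0.
Proof. by rewrite dotC dot0l. Qed.

Definition dot_lin := (dotDl, dotDr, dotZl, dotZr, dotNl, dotNr, dot0l, dot0r).

Lemma dot_ge0 u : 0 <= dot u u.
Proof. by rewrite dotE sumr_ge0 // => i _; rewrite -expr2 sqr_ge0. Qed.

Lemma dot_eq0 u : dot u u = 0 -> u = 0.
Proof.
rewrite dotE => /eqP; rewrite psumr_eq0; last first.
  by move=> i _; rewrite -expr2 sqr_ge0.
move=> /allP h; apply/matrixP => i j; rewrite (ord1 j) mxE.
by have := h i (mem_index_enum i); rewrite /= -expr2 sqrf_eq0 => /eqP.
Qed.

Lemma dot_gt0 u : u != 0 -> 0 < dot u u.
Proof.
move=> u0; rewrite lt_neqAle dot_ge0 andbT eq_sym.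
by apply: contraNneq u0 => /dot_eq0 ->.
Qed.

Lemma dot_mulmxl V u v : dot (V *m u) v = dot u (V^T *m v).
Proof. by rewrite /dot trmx_mul mulmxA. Qed.

Lemma rank1_mul a x : (a *m a^T) *m x = dot a x *: a.
Proof.
rewrite -mulmxA; apply/matrixP => i j; rewrite (ord1 j) !mxE big_ord_recl big_ord0.
by rewrite addr0 /dot mulrC [X in X * _ = _]mxE [in RHS]mxE.
Qed.

Lemma mxtrace_rank1 a : \tr (a *m a^T) = dot a a.
Proof. by rewrite mxtrace_mulC /mxtrace big_ord_recl big_ord0 addr0. Qed.

Lemma rank1_sym a : (a *m a^T)^T = a *m a^T.
Proof. by rewrite trmx_mul trmxK. Qed.

(** Evaluate at the vertex [- q / r]. For [r = 0] the polynomial is affine, and unless [q = 0] it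
    takes the value -1 at the chosen point. *)
Lemma discriminant_le0 (p q r : R) :
  0 <= r -> (forall t, 0 <= p + 2 * t * q + t ^+ 2 * r) -> q ^+ 2 <= p * r.
Proof.
rewrite le_eqVlt => /predU1P[<- h|r0 h].
  have [->|q0] := eqVneq q 0; first by rewrite expr0n /= mulr0.
  have := h (- (p + 1) / (2 * q)).
  have -> : p + 2 * (- (p + 1) / (2 * q)) * q + (- (p + 1) / (2 * q)) ^+ 2 * 0 = -1.
    by field.
  by rewrite ler0N1.
have := h (- q / r).
have -> : p + 2 * (- q / r) * q + (- q / r) ^+ 2 * r = (p * r - q ^+ 2) / r.
  by field; rewrite gt_eqF.
by rewrite pmulr_lge0 ?invr_gt0 // subr_ge0.
Qed.

End Dot.

Section QuadraticForms.
Variables (R : realFieldType) (n : nat).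
Implicit Types (u v x y a : 'cV[R]_n) (U V : 'M[R]_n).

Definition qform V x : R := dot x (V *m x).

(** Positive definiteness as a uniform lower bound: it survives the addition of semidefinite terms,
    gives invertibility and bounds the eigenvalues away from zero. *)
Definition coercive V := V^T = V /\ exists2 l : R, 0 < l & forall x, l * dot x x <= qform V x.

Lemma qformDl U V x : qform (U + V) x = qform U x + qform V x.
Proof. by rewrite /qform mulmxDl dotDr. Qed.

Lemma qformZl (c : R) V x : qform (c *: V) x = c * qform V x.
Proof. by rewrite /qform -scalemxAl dotZr. Qed.

Lemma qform_scalar (c : R) x : qform c%:M x = c * dot x x.
Proof. by rewrite /qform mul_scalar_mx dotZr. Qed.

Lemma qform_rank1 a x : qform (a *m a^T) x = dot a x ^+ 2.
Proof. by rewrite /qform rank1_mul dotZr [dot x a]dotC expr2. Qed.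

Lemma qform_suml (I : Type) (r : seq I) (F : I -> 'M[R]_n) x :
  qform (\sum_(i <- r) F i) x = \sum_(i <- r) qform (F i) x.
Proof.
by apply: (big_morph (qform^~ x)) => [U V|]; rewrite ?qformDl // /qform mul0mx dot0r.
Qed.

Lemma qform_cauchy_schwarz V x y : V^T = V -> (forall z, 0 <= qform V z) ->
  dot x (V *m y) ^+ 2 <= qform V x * qform V y.
Proof.
move=> sV V0; apply: discriminant_le0 => // t.
have := V0 (x + t *: y); rewrite /qform !(mulmxDr, dot_lin) -!scalemxAr !dotZr.
have -> : dot y (V *m x) = dot x (V *m y) by rewrite dotC dot_mulmxl sV.
by congr (_ <= _); ring.
Qed.

Lemma cauchy_schwarz x y : dot x y ^+ 2 <= dot x x * dot y y.
Proof.
have := @qform_cauchy_schwarz 1%:M x y; rewrite !qform_scalar !mul1mx !mul1r; apply.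
  exact: trmx1.
by move=> z; rewrite qform_scalar mul1r dot_ge0.
Qed.

Lemma coercive_ge0 V x : coercive V -> 0 <= qform V x.
Proof. by move=> [_ [l l0 h]]; apply: le_trans (h x); rewrite mulr_ge0 ?dot_ge0 ?ltW. Qed.

Lemma coercive_unit V : coercive V -> V \in unitmx.
Proof.
move=> [sV [l l0 h]]; rewrite unitmxE unitfE; apply/det0P => -[v v0 vV].
have := h v^T.
rewrite /qform; have -> : V *m v^T = 0 by rewrite -sV -trmx_mul vV trmx0.
rewrite dot0r leNgt mulr_gt0 // dot_gt0 //.
by apply: contra v0 => /eqP e; rewrite -[v]trmxK e trmx0.
Qed.

Lemma coerciveD U V : coercive U -> V^T = V -> (forall x, 0 <= qform V x) ->
  coercive (U + V).
Proof.
move=> [sU [l l0 h]] sV V0; split; first by rewrite linearD /= sU sV.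
by exists l => // x; rewrite qformDl; apply: ler_wpDr.
Qed.

Lemma coercive_rank1 V (w : R) a : coercive V -> 0 <= w -> coercive (V + w *: (a *m a^T)).
Proof.
move=> cV w0; apply: coerciveD => //; first by rewrite linearZ /= rank1_sym.
by move=> x; rewrite qformZl qform_rank1 mulr_ge0 // sqr_ge0.
Qed.

Lemma sym_inv V : V^T = V -> (invmx V)^T = invmx V.
Proof. by move=> sV; rewrite trmx_inv sV. Qed.

Lemma qform_inv V x : coercive V -> qform V (invmx V *m x) = qform (invmx V) x.
Proof.
move=> cV; have [sV _] := cV.
by rewrite /qform mulKVmx ?coercive_unit // dotC.
Qed.

Lemma qform_inv_ge0 V x : coercive V -> 0 <= qform (invmx V) x.
Proof. by move=> cV; rewrite -qform_inv // coercive_ge0. Qed.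

Lemma dual_cauchy_schwarz V x y : coercive V ->
  dot x y ^+ 2 <= qform V x * qform (invmx V) y.
Proof.
move=> cV; have [sV _] := cV; rewrite -(qform_inv y cV).
have {1}-> : y = V *m (invmx V *m y) by rewrite mulKVmx ?coercive_unit.
by apply: qform_cauchy_schwarz => // z; exact: coercive_ge0.
Qed.

(** Inversion reverses the order, shown without matrix square roots: for [z = invmx U *m x] both
    [qform U z] and [dot z x] equal the left side, so dual Cauchy-Schwarz bounds its square by [c]
    times itself times the right-hand form. *)
Lemma qform_inv_le U V (c : R) x : coercive U -> coercive V -> 0 <= c ->
  (forall y, qform V y <= c * qform U y) ->
  qform (invmx U) x <= c * qform (invmx V) x.
Proof.
move=> cU cV c0 h; set z := invmx U *m x.
have zz : qform (invmx U) x = dot z x by rewrite /qform dotC.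
have p0 := qform_inv_ge0 x cV; have s0 := qform_inv_ge0 x cU.
have := dual_cauchy_schwarz z x cV; rewrite -zz => le1.
have le2 : qform V z <= c * qform (invmx U) x by rewrite -(qform_inv x cU); apply: h.
have {le1 le2} : qform (invmx U) x ^+ 2 <= c * qform (invmx U) x * qform (invmx V) x.
  by apply: le_trans le1 _; rewrite ler_wpM2r.
have [->|s1] := eqVneq (qform (invmx U) x) 0; first by rewrite mulr_ge0.
have {}s1 : 0 < qform (invmx U) x by rewrite lt_neqAle eq_sym s1.
by rewrite expr2 mulrAC ler_pM2r.
Qed.

Section RankOneUpdate.
Variables (U : 'M[R]_n) (w : R) (a : 'cV[R]_n).
Hypotheses (cU : coercive U) (w0 : 0 <= w).
Let U' := U + w *: (a *m a^T).
Let p := qform (invmx U) a.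

Lemma rank1_update_gt0 : 0 < 1 + w * p.
Proof. by rewrite ltr_wpDr // mulr_ge0 // qform_inv_ge0. Qed.

Lemma invmx_rank1_mul : invmx U' *m a = (1 + w * p)^-1 *: (invmx U *m a).
Proof.
have cU' : coercive U' by exact: coercive_rank1.
have e : U' *m (invmx U *m a) = (1 + w * p) *: a.
  rewrite mulmxDl mulKVmx ?coercive_unit // -scalemxAl rank1_mul scalerDl scale1r scalerA.
  by rewrite /p /qform.
have ne : 1 + w * p != 0 by rewrite gt_eqF // rank1_update_gt0.
apply: (can_inj (mulKmx (coercive_unit cU'))).
by rewrite mulKVmx ?coercive_unit // -scalemxAr e scalerA mulVf // scale1r.
Qed.

Lemma qform_invmx_rank1 : qform (invmx U') a = p / (1 + w * p).
Proof. by rewrite /qform invmx_rank1_mul dotZr mulrC. Qed.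

(** The matrix determinant lemma: the bordered matrix [M] is factored once by eliminating its lower
    and once by eliminating its upper block. *)
Lemma det_rank1 : \det U' = \det U * (1 + w * p).
Proof.
pose M : 'M[R]_(1 + n) := block_mx 1%:M (- (w *: a^T)) a U.
have e1 : M = block_mx 1%:M 0 a 1%:M *m block_mx 1%:M (- (w *: a^T)) 0 U'.
  rewrite mulmx_block !(mul1mx, mulmx1, mul0mx, mulmx0, addr0) /U' mulmxN -scalemxAr.
  by rewrite [- _ + _]addrC addrK.
have e2 : M = block_mx (1%:M + w *: a^T *m invmx U *m a) (- (w *: a^T *m invmx U)) 0 1%:M
              *m block_mx 1%:M 0 a U.
  rewrite mulmx_block !(mul1mx, mulmx1, mul0mx, mulmx0, add0r) mulNmx addrK.
  by rewrite !mulNmx mulmxKV ?coercive_unit.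
have := congr1 determinant e2; rewrite {1}e1 !det_mulmx !det_lblock !det_ublock !det1 !mul1r.
rewrite !mulr1 => ->; rewrite mulrC; congr (_ * _).
by rewrite [LHS]det_mx11 -mulmxA mxE [X in X + _]mxE -scalemxAl [X in _ + X]mxE.
Qed.
End RankOneUpdate.

End QuadraticForms.

(** * Spectral decomposition in the chosen eigenbasis *)

Section Spectral.
Variables (R : realType) (n : nat) (V Q : 'M[R]_n.+2).
Hypotheses (sV : V^T = V) (sp : eig_spec V Q).
Implicit Types (x y : 'cV[R]_n.+2) (i : 'I_n.+2).

Lemma col_coord i x : dot (col i Q) x = (Q^T *m x) i ord0.
Proof. by rewrite dotE mxE; apply: eq_bigr => j _; rewrite !mxE. Qed.

Lemma eigval_qform i : eigval V Q i = qform V (col i Q).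
Proof.
rewrite /eigval -mulmxA mxE /qform.
have -> : V *m col i Q = col i (V *m Q) by rewrite !colE mulmxA.
rewrite dotE.
by apply: eq_bigr => k _; rewrite !mxE.
Qed.

Lemma dot_spectral x y : dot x y = \sum_i dot (col i Q) x * dot (col i Q) y.
Proof.
have [QQ _] := sp; have QQ' := mulmx1C QQ.
have -> : dot x y = dot (Q^T *m x) (Q^T *m y).
  by rewrite dot_mulmxl trmxK mulmxA QQ' mul1mx.
by rewrite dotE; apply: eq_bigr => i _; rewrite !col_coord.
Qed.

Lemma coord_mul i x : dot (col i Q) (V *m x) = eigval V Q i * dot (col i Q) x.
Proof.
have [_ [h _]] := sp.
by rewrite -{1}sV -dot_mulmxl h dotZl.
Qed.

Lemma qform_spectral x : qform V x = \sum_i eigval V Q i * dot (col i Q) x ^+ 2.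
Proof.
rewrite /qform dot_spectral; apply: eq_bigr => i _.
by rewrite coord_mul expr2; ring.
Qed.

Lemma dot_col i j : dot (col i Q) (col j Q) = (i == j)%:R.
Proof.
have [QQ _] := sp.
by rewrite col_coord colE mulmxA QQ mul1mx mxE eqxx andbT.
Qed.

Lemma eigval_ge_min i : eigval V Q ord0 <= eigval V Q i.
Proof. by have [_ [_ h]] := sp; apply: h. Qed.

Lemma eigval_le_max i : eigval V Q i <= eigval V Q ord_max.
Proof. by have [_ [_ h]] := sp; apply: h; rewrite -ltnS. Qed.

Lemma qform_ge_min x : eigval V Q ord0 * dot x x <= qform V x.
Proof.
rewrite qform_spectral dot_spectral mulr_sumr; apply: ler_sum => i _.
by rewrite -expr2 ler_wpM2r ?sqr_ge0 ?eigval_ge_min.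
Qed.

Lemma qform_le_max x : qform V x <= eigval V Q ord_max * dot x x.
Proof.
rewrite qform_spectral dot_spectral mulr_sumr; apply: ler_sum => i _.
by rewrite -expr2 ler_wpM2r ?sqr_ge0 ?eigval_le_max.
Qed.

Lemma le_eigval (c : R) i : (forall x, c * dot x x <= qform V x) -> c <= eigval V Q i.
Proof. by move=> /(_ (col i Q)); rewrite dot_col eqxx mulr1 -eigval_qform. Qed.

Lemma eigval_le (c : R) i : (forall x, qform V x <= c * dot x x) -> eigval V Q i <= c.
Proof. by move=> /(_ (col i Q)); rewrite dot_col eqxx mulr1 -eigval_qform. Qed.

Lemma mxtrace_spectral : \tr V = \sum_i eigval V Q i.
Proof.
have [QQ _] := sp; rewrite -[RHS]/(\tr (Q^T *m V *m Q)).
by rewrite mxtrace_mulC mulmxA (mulmx1C QQ) mul1mx.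
Qed.

Lemma det_spectral : \det V = \prod_i eigval V Q i.
Proof.
have [QQ [h _]] := sp.
have -> : \det V = \det (Q^T *m V *m Q).
  by rewrite !det_mulmx mulrAC -det_mulmx QQ det1 mul1r.
have -> : Q^T *m V *m Q = diag_mx (\row_i eigval V Q i).
  apply/matrixP => i j; rewrite mxE [RHS]mxE mxE.
  have -> : \sum_k (Q^T *m V) i k * Q k j = dot (col i Q) (V *m col j Q).
    rewrite col_coord mulmxA !mxE; apply: eq_bigr => k _; by rewrite [col j Q _ _]mxE.
  rewrite h dotZr dot_col; have [->|] := eqVneq i j; first by rewrite mulr1 mulr1n.
  by rewrite mulr0 mulr0n.
by rewrite det_diag; apply: eq_bigr => i _; rewrite mxE.
Qed.

Lemma eigval_gt0 : coercive V -> forall i, 0 < eigval V Q i.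
Proof. by move=> [_ [l l0 h]] i; apply: lt_le_trans l0 (le_eigval i h). Qed.

Lemma det_gt0 : coercive V -> 0 < \det V.
Proof. by move=> cV; rewrite det_spectral prodr_gt0 // => i _; exact: eigval_gt0. Qed.

Lemma det_le_trace : (forall x, 0 <= qform V x) -> \det V <= (\tr V / n.+2%:R) ^+ n.+2.
Proof.
move=> V0; rewrite det_spectral mxtrace_spectral.
have := @leif_AGM R 'I_n.+2 predT (eigval V Q); rewrite card_ord.
case=> [i _|+ _]; last by [].
by rewrite eigval_qform.
Qed.

End Spectral.

(** * Norms and normalization *)

Section Norms.
Variables (R : realType) (n : nat).
Implicit Types (x y : 'cV[R]_n.+2) (V : 'M[R]_n.+2).

Lemma VnormE V x : Vnorm V x = Num.sqrt (qform V x).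
Proof. by rewrite /Vnorm /qform /dot mulmxA. Qed.

Lemma vnormE x : vnorm x = Num.sqrt (dot x x).
Proof. by rewrite /vnorm dotE; congr Num.sqrt; apply: eq_bigr => i _; rewrite expr2. Qed.

Lemma vnorm_Vnorm1 x : vnorm x = Vnorm 1%:M x.
Proof. by rewrite vnormE VnormE qform_scalar mul1r. Qed.

Lemma Vnorm_ge0 V x : 0 <= Vnorm V x.
Proof. by rewrite VnormE sqrtr_ge0. Qed.

Lemma vnorm_ge0 x : 0 <= vnorm x.
Proof. by rewrite vnormE sqrtr_ge0. Qed.

Lemma VnormZ V (c : R) x : Vnorm V (c *: x) = `|c| * Vnorm V x.
Proof.
rewrite !VnormE /qform -scalemxAr dotZl dotZr mulrA -expr2 sqrtrM ?sqr_ge0 //.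
by rewrite sqrtr_sqr.
Qed.

Lemma VnormN V x : Vnorm V (- x) = Vnorm V x.
Proof. by rewrite -scaleN1r VnormZ normrN1 mul1r. Qed.

Lemma VnormD V x y : V^T = V -> (forall z, 0 <= qform V z) ->
  Vnorm V (x + y) <= Vnorm V x + Vnorm V y.
Proof.
move=> sV V0; rewrite !VnormE.
have sx := sqrtr_ge0 (qform V x); have sy := sqrtr_ge0 (qform V y).
rewrite -[leRHS]ger0_norm ?addr_ge0 // -sqrtr_sqr ler_wsqrtr // sqrrD !sqr_sqrtr //.
have -> : qform V (x + y) = qform V x + (dot x (V *m y)) *+ 2 + qform V y.
  rewrite /qform mulmxDr !dot_lin [dot y (V *m x)]dotC dot_mulmxl sV mulr2n; ring.
rewrite lerD2r lerD2l ler_wMn2r //.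
rewrite -sqrtrM // (le_trans (ler_norm _)) // -sqrtr_sqr ler_wsqrtr //.
exact: qform_cauchy_schwarz.
Qed.

Lemma Vnorm_distC V x y : Vnorm V (x - y) = Vnorm V (y - x).
Proof. by rewrite -VnormN opprB. Qed.

Lemma vnorm_sqr x : vnorm x ^+ 2 = dot x x.
Proof. by rewrite vnormE sqr_sqrtr // dot_ge0. Qed.

Lemma vnormZ (c : R) x : vnorm (c *: x) = `|c| * vnorm x.
Proof. by rewrite !vnorm_Vnorm1 VnormZ. Qed.

Lemma vnormD x y : vnorm (x + y) <= vnorm x + vnorm y.
Proof.
rewrite !vnorm_Vnorm1; apply: VnormD; first exact: trmx1.
by move=> z; rewrite qform_scalar mul1r dot_ge0.
Qed.

Lemma vnormN x : vnorm (- x) = vnorm x.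
Proof. by rewrite !vnorm_Vnorm1 VnormN. Qed.

Lemma vnormB x y : vnorm (x - y) <= vnorm x + vnorm y.
Proof. by rewrite -[vnorm y]vnormN vnormD. Qed.

Lemma vnorm0 : vnorm (0 : 'cV[R]_n.+2) = 0.
Proof. by rewrite vnormE dot0l sqrtr0. Qed.

Lemma vnorm_eq0 x : vnorm x = 0 -> x = 0.
Proof. by move=> h; apply: dot_eq0; rewrite -vnorm_sqr h expr0n. Qed.

(** Normalizing moves [x] by [|1 - vnorm x|], which is at most [vnorm (x - y)] since [y] is a unit
    vector. For [x = 0] the convention [0^-1 = 0] keeps the vector at zero. *)
Lemma normalize_dist x y : vnorm y = 1 -> vnorm ((vnorm x)^-1 *: x - y) <= 2 * vnorm (x - y).
Proof.
move=> y1; have [x0|x0] := eqVneq (vnorm x) 0.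
  by rewrite x0 invr0 scale0r (vnorm_eq0 x0) sub0r vnormN y1; lra.
have -> : (vnorm x)^-1 *: x - y = ((vnorm x)^-1 - 1) *: x + (x - y).
  by rewrite scalerBl scale1r addrA subrK.
apply: le_trans (vnormD _ _) _; rewrite vnormZ mulr_natl mulr2n lerD2r.
have -> : `|(vnorm x)^-1 - 1| * vnorm x = `|1 - vnorm x|.
  rewrite -{2}[vnorm x]ger0_norm ?vnorm_ge0 // -normrM mulrBl mul1r mulVf //.
have h1 := vnormD (x - y) y; have h2 := vnormB x (x - y).
rewrite subrK in h1; have e : x - (x - y) = y by rewrite opprB addrC subrK.
rewrite e in h2; rewrite y1 in h1 h2.
by rewrite ler_norml; lra.
Qed.

Lemma dot_sub_sqr x y : dot (x - y) (x - y) = dot x x - 2 * dot x y + dot y y.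
Proof. by rewrite !dot_lin [dot y x]dotC; ring. Qed.

Lemma dot_orth_part x y : dot y y = 1 ->
  dot (x - dot x y *: y) (x - dot x y *: y) = dot x x - dot x y ^+ 2.
Proof. by move=> y1; rewrite !dot_lin y1 [dot y x]dotC; ring. Qed.

(** The left side is the squared distance from [y] to the line spanned by [c], the right side that
    to one point of the line. *)
Lemma sin_sqr_le c y (t : R) : dot c c = 1 -> dot y y = 1 ->
  1 - dot c y ^+ 2 <= dot (y - t *: c) (y - t *: c).
Proof.
move=> c1 y1; rewrite !dot_lin c1 y1 [dot y c]dotC.
have := sqr_ge0 (t - dot c y); rewrite sqrrB; nra.
Qed.

Lemma sin_sqr_normalize x y : dot y y = 1 -> x != 0 ->
  1 - dot ((vnorm x)^-1 *: x) y ^+ 2 <= dot (x - y) (x - y).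
Proof.
move=> y1 x0; set c := _ *: x.
have nx : vnorm x != 0 by apply: contra x0 => /eqP/vnorm_eq0 ->.
have c1 : dot c c = 1.
  by rewrite /c !dot_lin -vnorm_sqr; field.
have -> : dot (x - y) (x - y) = dot (y - vnorm x *: c) (y - vnorm x *: c).
  by rewrite /c scalerA mulfV // scale1r -opprB dotNl dotNr opprK.
exact: sin_sqr_le.
Qed.

End Norms.

(** * Actions of a batch *)

Section Action.
Variables (R : realType) (n : nat) (eigf : 'M[R]_n.+2 -> 'M[R]_n.+2) (V : 'M[R]_n.+2).
Hypotheses (sV : V^T = V) (sp : eig_spec V (eigf V)).
Let lam := eigval V (eigf V) ord0.
Hypothesis lam2 : 2 <= lam.
Variable th : 'cV[R]_n.+2.
Let c := (vnorm th)^-1 *: th.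
Let v (i : 'I_n.+1) := col (widen_ord (leqnSn n.+1) i) (eigf V).
Let At (sg : bool) i := c + (if sg then 1 else -1) * (Num.sqrt lam)^-1 *: v i.

Lemma actionE sg i : action eigf V th sg i = (vnorm (At sg i))^-1 *: At sg i.
Proof. by []. Qed.

Lemma lam_gt0 : 0 < lam.
Proof. exact: lt_le_trans lam2. Qed.

Lemma sqrt_lam_ge : 7 / 5 <= Num.sqrt lam.
Proof.
have -> : 7 / 5 = Num.sqrt ((7 / 5) ^+ 2) :> R by rewrite sqrtr_sqr ger0_norm //; lra.
by rewrite ler_wsqrtr //; apply: le_trans lam2; lra.
Qed.

Lemma sqr_sqrt_lam : Num.sqrt lam ^+ 2 = lam.
Proof. by rewrite sqr_sqrtr // ltW // lam_gt0. Qed.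

(** On a bad history the estimate may vanish, and [0^-1 = 0] then makes the centre zero. The bounds
    valid on all paths must allow this; the action stays well defined because the perturbation alone
    is nonzero, and it is shorter than a unit centre as [lam >= 2]. *)
Lemma vnorm_center : c = 0 \/ vnorm c = 1.
Proof.
rewrite /c; have [t0|t0] := eqVneq (vnorm th) 0; first by left; rewrite t0 invr0 scale0r.
by right; rewrite vnormZ ger0_norm ?invr_ge0 ?vnorm_ge0 // mulVf.
Qed.

Lemma vnorm_dir (sg : bool) i :
  vnorm ((if sg then 1 else -1) * (Num.sqrt lam)^-1 *: v i) = (Num.sqrt lam)^-1.
Proof.
rewrite vnormZ normrM; have -> : `|if sg then 1 else -1 : R| = 1.
  by case: sg; rewrite ?normrN1 ?normr1.
have -> : vnorm (v i) = 1 by rewrite vnormE /v (dot_col sp) eqxx sqrtr1.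
by rewrite mul1r mulr1 ger0_norm // invr_ge0 sqrtr_ge0.
Qed.

Lemma inv_sqrt_lam : 0 < (Num.sqrt lam)^-1 /\ (Num.sqrt lam)^-1 <= 5 / 7.
Proof.
have h := sqrt_lam_ge; split; first by rewrite invr_gt0; lra.
by rewrite -[5 / 7]invrK lef_pV2 ?posrE ?invf_div //; lra.
Qed.

Lemma vnorm_At_le sg i : vnorm (At sg i) <= 1 + (Num.sqrt lam)^-1.
Proof.
apply: le_trans (vnormD _ _) _; rewrite vnorm_dir lerD2r.
by case: vnorm_center => ->; rewrite ?vnorm0.
Qed.

Lemma vnorm_At_ge sg i : c != 0 -> 1 - (Num.sqrt lam)^-1 <= vnorm (At sg i).
Proof.
move=> c0; case: vnorm_center => [e|c1]; first by rewrite e eqxx in c0.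
have := vnormB (At sg i) ((if sg then 1 else -1) * (Num.sqrt lam)^-1 *: v i).
by rewrite /At addrK vnorm_dir c1 lerBlDr.
Qed.

Lemma vnorm_At_gt0 sg i : 0 < vnorm (At sg i).
Proof.
have [i0 i1] := inv_sqrt_lam.
have [c0|c0] := eqVneq c 0; first by rewrite /At c0 add0r vnorm_dir.
by apply: lt_le_trans (vnorm_At_ge sg i c0); lra.
Qed.

Lemma action_unit sg i : dot (action eigf V th sg i) (action eigf V th sg i) = 1.
Proof.
have h := vnorm_At_gt0 sg i.
by rewrite actionE dotZl dotZr -vnorm_sqr; field; rewrite gt_eqF.
Qed.

(* Both normalizing factors of a pair are at most [1 + 1/sqrt lam]; the contribution of the
   common centre is discarded. *)
Lemma action_pair_ge i x :
  2 / (Num.sqrt lam + 1) ^+ 2 * dot (v i) x ^+ 2 <=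
  dot (action eigf V th true i) x ^+ 2 + dot (action eigf V th false i) x ^+ 2.
Proof.
have s0 := sqrt_lam_ge; have [i0 i1] := inv_sqrt_lam.
set s := Num.sqrt lam in s0 i0 i1 *.
have one sg : (1 + s^-1) ^- 2 * dot (At sg i) x ^+ 2 <= dot (action eigf V th sg i) x ^+ 2.
  have N0 := vnorm_At_gt0 sg i; have N1 := vnorm_At_le sg i.
  have D0 : 0 < 1 + s^-1 by lra.
  rewrite actionE dotZl exprMn ler_wpM2r ?sqr_ge0 // exprVn lef_pV2 ?posrE ?exprn_gt0 //.
  by rewrite ler_sqr ?nnegrE ?vnorm_ge0 // ltW.
apply: le_trans (lerD (one true) (one false)); rewrite -mulrDr.
have -> : 2 / (s + 1) ^+ 2 * dot (v i) x ^+ 2 = (1 + s^-1) ^- 2 * (2 * (s^-1 * dot (v i) x) ^+ 2).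
  move: (dot (v i) x) => d; field; rewrite !gt_eqF //; lra.
rewrite ler_wpM2l ?invr_ge0 ?sqr_ge0 // /At !dot_lin mul1r mulN1r -/s.
set p := dot c x; set q := s^-1 * _.
have := sqr_ge0 p; have -> : (- s^-1) * dot (v i) x = - q by rewrite mulNr.
rewrite !sqrrD sqrrN; nra.
Qed.

Section NearTarget.
Variables (y : 'cV[R]_n.+2) (B : R).
Hypotheses (y1 : dot y y = 1) (B0 : 0 <= B) (Blam : B ^+ 2 < lam).
Hypothesis hB : lam * dot (th - y) (th - y) <= B ^+ 2.

Lemma estimate_dist : vnorm (th - y) <= B / Num.sqrt lam.
Proof.
have s0 := sqrt_lam_ge.
have s1 : 0 < Num.sqrt lam by lra.
rewrite ler_pdivlMr //.
rewrite -[leRHS]ger0_norm // -sqrtr_sqr vnormE -sqrtrM ?dot_ge0 // ler_wsqrtr //.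
by rewrite mulrC.
Qed.

Lemma estimate_neq0 : th != 0.
Proof.
apply/negP => /eqP t0; have := hB; rewrite t0 sub0r dotNl dotNr opprK y1 mulr1.
by rewrite leNgt Blam.
Qed.

(** The left side is at most the squared distance from the action to any multiple of [y]. Before
    normalization the part of the centre across [y] has length at most [B / sqrt lam], the
    perturbation has length [1 / sqrt lam], and the norm divided by is at least
    [1 - 1 / sqrt lam]. *)
Lemma action_variance sg i :
  1 - dot (action eigf V th sg i) y ^+ 2 <= ((B + 1) / (Num.sqrt lam - 1)) ^+ 2.
Proof.
have s0 := sqrt_lam_ge; have [i0 i1] := inv_sqrt_lam.
have B1 : 0 <= B + 1 by rewrite addr_ge0.
have s1 : 0 < Num.sqrt lam - 1 by lra.
have s2 := ltW s1.
have N2 : 0 < 1 - (Num.sqrt lam)^-1 by lra.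
have es : (B + 1) / (Num.sqrt lam - 1) = (1 - (Num.sqrt lam)^-1)^-1 * (B / Num.sqrt lam + (Num.sqrt lam)^-1).
  by field; rewrite !gt_eqF //; lra.
have N0 := vnorm_At_gt0 sg i.
have c0 : c != 0.
  rewrite /c scaler_eq0 negb_or estimate_neq0 invr_eq0 andbT.
  by apply: contra estimate_neq0 => /eqP/vnorm_eq0 ->.
have N1 := vnorm_At_ge sg i c0.
set A := action _ _ _ _ _; set N := vnorm _ in N0 N1.
(* This multiple removes the component of the centre only; the perturbation is bounded by its full
   length. *)
pose z := dot c y / N.
have h1 : 1 - dot A y ^+ 2 <= dot (A - z *: y) (A - z *: y).
  by rewrite dotC; apply: sin_sqr_le => //; exact: action_unit.
apply: le_trans h1 _; rewrite -vnorm_sqr.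
have -> : A - z *: y = N^-1 *: ((c - dot c y *: y)
      + (if sg then 1 else -1) * (Num.sqrt lam)^-1 *: v i).
  rewrite /A actionE -/N /At /z !scalerDr scalerN !scalerA -!addrA; congr (_ + _).
  by rewrite addrC mulrC.
have h2 : vnorm (c - dot c y *: y) <= B / Num.sqrt lam.
  apply: le_trans estimate_dist; rewrite !vnormE ler_wsqrtr //.
  apply: le_trans (sin_sqr_normalize y1 estimate_neq0); rewrite -/c.
  have [cz|c1] := vnorm_center; first by rewrite cz eqxx in c0.
  by rewrite dot_orth_part // -[dot c c]vnorm_sqr c1 expr1n.
have h3 := vnormD (c - dot c y *: y) ((if sg then 1 else -1) * (Num.sqrt lam)^-1 *: v i).
rewrite vnorm_dir in h3.
rewrite ler_sqr ?nnegrE ?vnorm_ge0 ?divr_ge0 //.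
rewrite vnormZ ger0_norm ?invr_ge0 ?vnorm_ge0 //.
rewrite es.
apply: ler_pM; rewrite ?invr_ge0 ?vnorm_ge0 //; last by apply: le_trans h3 _; rewrite lerD2r.
by rewrite lef_pV2 ?posrE.
Qed.

(** Between unit vectors the loss is half the squared distance. Two normalizations, of the estimate
    and of the action, cost a factor 2 each. *)
Lemma action_regret sg i :
  1 - dot (action eigf V th sg i) y <= 2 * (2 * B + 1) ^+ 2 / lam.
Proof.
have s0 := sqrt_lam_ge; have [i0 i1] := inv_sqrt_lam.
set A := action _ _ _ _ _.
have A1 : dot A A = 1 by exact: action_unit.
have -> : 1 - dot A y = 2^-1 * vnorm (A - y) ^+ 2.
  by rewrite vnorm_sqr dot_sub_sqr A1 y1; field.
have ny : vnorm y = 1 by rewrite vnormE y1 sqrtr1.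
have h1 : vnorm (A - y) <= 2 * vnorm (At sg i - y) by rewrite /A actionE normalize_dist.
have h2 : vnorm (At sg i - y) <= vnorm (c - y) + (Num.sqrt lam)^-1.
  have -> : At sg i - y = (c - y) + (if sg then 1 else -1) * (Num.sqrt lam)^-1 *: v i.
    by rewrite /At addrAC.
  by apply: le_trans (vnormD _ _) _; rewrite vnorm_dir.
have h3 : vnorm (c - y) <= 2 * (B / Num.sqrt lam).
  by apply: le_trans (normalize_dist _ ny) _; rewrite ler_pM2l // estimate_dist.
have B0' := B0.
have h4 : vnorm (A - y) <= 2 * ((2 * B + 1) / Num.sqrt lam).
  by apply: le_trans h1 _; rewrite ler_pM2l // mulrDl mul1r; lra.
have -> : 2 * (2 * B + 1) ^+ 2 / lam = 2^-1 * (2 * ((2 * B + 1) / Num.sqrt lam)) ^+ 2.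
  by rewrite !exprMn exprVn sqr_sqrt_lam; field; rewrite gt_eqF // lam_gt0.
rewrite ler_pM2l ?invr_gt0 // ler_sqr ?nnegrE ?vnorm_ge0 //.
by rewrite mulr_ge0 // divr_ge0 //; lra.
Qed.

End NearTarget.
End Action.

(** * Growth of the design matrix *)

Section Batch.
Variables (R : realType) (n : nat) (eigf : 'M[R]_n.+2 -> 'M[R]_n.+2).
Hypothesis heig : forall V, V^T = V -> eig_spec V (eigf V).
Variables (V : 'M[R]_n.+2) (th : 'cV[R]_n.+2) (w : R).
Hypotheses (sV : V^T = V) (w0 : 0 <= w).
Let lam_min U := eigval U (eigf U) ord0.
Let lam_max U := eigval U (eigf U) ord_max.
Hypothesis lam2 : 2 <= lam_min V.

Definition batch_gram : 'M[R]_n.+2 :=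
  \sum_(i < n.+1) (action eigf V th true i *m (action eigf V th true i)^T +
                   action eigf V th false i *m (action eigf V th false i)^T).

Let V' := V + w *: batch_gram.

Lemma batch_gram_sym : batch_gram^T = batch_gram.
Proof.
rewrite /batch_gram linear_sum; apply: eq_bigr => i _.
by rewrite linearD /= !rank1_sym.
Qed.

Lemma qform_batch_gram x : qform batch_gram x =
  \sum_(i < n.+1) (dot (action eigf V th true i) x ^+ 2 + dot (action eigf V th false i) x ^+ 2).
Proof.
by rewrite qform_suml; apply: eq_bigr => i _; rewrite qformDl !qform_rank1.
Qed.

Lemma batch_sym : V'^T = V'.
Proof. by rewrite /V' linearD linearZ /= batch_gram_sym sV. Qed.

Lemma batch_qform_ge x : qform V x <= qform V' x.
Proof.
rewrite qformDl qformZl lerDl mulr_ge0 // qform_batch_gram.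
by apply: sumr_ge0 => i _; rewrite addr_ge0 ?sqr_ge0.
Qed.

Lemma batch_trace : \tr V' = \tr V + w * (2 * n.+1%:R).
Proof.
rewrite linearD linearZ /= /batch_gram linear_sum /=; congr (_ + _ * _).
rewrite (eq_bigr (fun=> 2)) => [|i _].
  by rewrite sumr_const card_ord mulr_natr.
rewrite linearD /= !mxtrace_rank1 !action_unit //; exact: heig.
Qed.

Lemma batch_lmax : lam_max V' <= lam_max V + w * (2 * n.+1%:R).
Proof.
apply: (eigval_le (heig batch_sym)) => x.
rewrite qformDl qformZl mulrDl; apply: lerD; first exact: (qform_le_max sV (heig sV)).
rewrite -mulrA ler_wpM2l //.
rewrite qform_batch_gram.
have -> : 2 * n.+1%:R * dot x x = \sum_(i < n.+1) (dot x x + dot x x).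
  by rewrite sumr_const card_ord -mulr_natr; ring.
apply: ler_sum => i _; have h := heig sV.
apply: lerD; apply: le_trans (cauchy_schwarz _ _) _;
  by rewrite action_unit // mul1r.
Qed.

(** In the eigenbasis of [V] every direction except the top one is a perturbation direction and
    gains at least the second summand by [action_pair_ge]. The top direction has no guaranteed gain,
    whence the separate condition [m <= lam_max V]. *)
Lemma batch_lmin (m : R) :
  m <= lam_min V + 2 * w / (Num.sqrt (lam_min V) + 1) ^+ 2 -> m <= lam_max V -> m <= lam_min V'.
Proof.
move=> m1 m2; have h := heig sV.
apply: (le_eigval (heig batch_sym)) => x.
rewrite qformDl qformZl (qform_spectral sV h) (dot_spectral h) qform_batch_gram.
set D := 2 * w / _ in m1.
have le1 : D * (\sum_(i < n.+1) dot (col (widen_ord (leqnSn n.+1) i) (eigf V)) x ^+ 2) <=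
    w * (\sum_(i < n.+1) (dot (action eigf V th true i) x ^+ 2 + dot (action eigf V th false i) x ^+ 2)).
  rewrite /D [2 * w]mulrC -mulrA -mulrA ler_wpM2l // mulrA mulr_sumr; apply: ler_sum => i _.
  exact: action_pair_ge.
apply: le_trans (lerD (lexx _) le1).
move: D m1 le1 => D m1 _.
rewrite [X in m * X]big_ord_recr [X in _ <= X + _]big_ord_recr /=.
rewrite mulrDr addrAC; apply: lerD; last by rewrite -expr2 ler_wpM2r ?sqr_ge0.
rewrite [X in X <= _]mulr_sumr [X in _ <= _ + X]mulr_sumr -big_split /=; apply: ler_sum => i _.
rewrite -expr2 -mulrDl ler_wpM2r ?sqr_ge0 //.
by apply: le_trans m1 _; rewrite lerD2r eigval_ge_min.
Qed.

End Batch.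

Section Process.
Variables (R : realType) (k : nat) (eigf : 'M[R]_3 -> 'M[R]_3)
  (med : seq R -> R) (argsel : seq R -> nat) (theta0 : 'cV[R]_3).
Hypothesis heig : forall V, V^T = V -> eig_spec V (eigf V).
Variable x : nat -> bool.

(** The factor in front of the square root in [omega], for dimension 3 and [lambda0 = 2]. *)
Definition mu : R := (12 * Num.sqrt 2 * beta_w 1 2)^-1.
Definition bandit_state s := lstate (n := 1) 2 k eigf med argsel theta0 x s.
Definition design_mx s := (bandit_state s).1.1.
Definition moment_vec s := (bandit_state s).1.2.
Definition estimate s := (bandit_state s).2.
Definition batch_weight s : R := if s == 0%N then 1 else omega 2 eigf (design_mx s).
Definition lam_min s := eigval (design_mx s) (eigf (design_mx s)) ord0.
Definition lam_max s := eigval (design_mx s) (eigf (design_mx s)) ord_max.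
Definition sqrt_lam_max s := Num.sqrt (lam_max s).
Definition design_trace s := \tr (design_mx s).
Definition sqrt_trace s := Num.sqrt (design_trace s).

Lemma design_mxS s : design_mx s.+1 =
  design_mx s + batch_weight s *: batch_gram eigf (design_mx s) (estimate s).
Proof.
rewrite /design_mx /batch_weight /estimate /bandit_state /design_mx /bandit_state /=.
by case: (lstate _ _ _ _ _ _ _ s) => [[V b] th]; reflexivity.
Qed.

Lemma sqrt2_ge : 7 / 5 <= Num.sqrt 2 :> R.
Proof.
have -> : 7 / 5 = Num.sqrt ((7 / 5) ^+ 2) :> R by rewrite sqrtr_sqr ger0_norm //; lra.
by rewrite ler_wsqrtr //; lra.
Qed.

Lemma sqrt3_ge : 17 / 10 <= Num.sqrt 3 :> R.
Proof.
have -> : 17 / 10 = Num.sqrt ((17 / 10) ^+ 2) :> R by rewrite sqrtr_sqr ger0_norm //; lra.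
by rewrite ler_wsqrtr //; lra.
Qed.

Lemma mu_gt0 : 0 < mu.
Proof.
have h2 := sqrt2_ge; have h3 := sqrt3_ge.
rewrite /mu invr_gt0 /beta_w; apply: mulr_gt0; first lra.
by rewrite mulr_gt0 // exprn_gt0 //; lra.
Qed.

(** The rational lower bounds 7/5 and 17/10 for the two roots make [mu^-1] at least
    [12 * 9 * 7/5 * (71/10)^2], about 7622. *)
Lemma mu_le : mu * (75 * 100) <= 1.
Proof.
have h2 := sqrt2_ge; have h3 := sqrt3_ge; have m0 := mu_gt0.
have mE : mu^-1 = 12 * Num.sqrt 2 * (9 * (3 * Num.sqrt 3 + 2) ^+ 2) by rewrite /mu invrK.
rewrite -[leRHS](mulfV (lt0r_neq0 m0)) ler_pM2l // mE.
have h4 : (71 / 10) ^+ 2 <= (3 * Num.sqrt 3 + 2) ^+ 2 :> R.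
  by rewrite ler_sqr ?nnegrE; lra.
have h5 : 7 / 5 * (71 / 10) ^+ 2 <= Num.sqrt 2 * (3 * Num.sqrt 3 + 2) ^+ 2 :> R.
  by apply: ler_pM.
lra.
Qed.

Lemma batch_weightS s : batch_weight s.+1 = mu * sqrt_lam_max s.+1.
Proof. by rewrite /batch_weight /omega /mu /sqrt_lam_max /lam_max mulrC. Qed.

Lemma batch_weight_ge0 s : 0 <= batch_weight s.
Proof. by case: s => [|s]; rewrite ?batch_weightS ?mulr_ge0 ?sqrtr_ge0 ?ltW ?mu_gt0. Qed.

Lemma design_sym_ge2 s : (design_mx s)^T = design_mx s /\ forall y, 2 * dot y y <= qform (design_mx s) y.
Proof.
elim: s => [|s [sV h]]; first by rewrite /design_mx /=; split=> [|y]; rewrite ?tr_scalar_mx ?qform_scalar.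
rewrite design_mxS; split; first exact: batch_sym.
by move=> y; apply: le_trans (h y) _; apply: batch_qform_ge => //; exact: batch_weight_ge0.
Qed.

Lemma design_sym s : (design_mx s)^T = design_mx s.
Proof. by case: (design_sym_ge2 s). Qed.

Lemma design_eig s : eig_spec (design_mx s) (eigf (design_mx s)).
Proof. exact/heig/design_sym. Qed.

Lemma lam_min_ge2 s : 2 <= lam_min s.
Proof. by apply: (le_eigval (design_eig s)); case: (design_sym_ge2 s). Qed.

Lemma design_coercive s : coercive (design_mx s).
Proof. by case: (design_sym_ge2 s) => h1 h2; split => //; exists 2. Qed.

Lemma design_trace0 : design_trace 0 = 6.
Proof. by rewrite /design_trace /design_mx /= mxtrace_scalar -mulr_natr; lra. Qed.

Lemma design_traceS s : design_trace s.+1 = design_trace s + 4 * batch_weight s.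
Proof.
by rewrite /design_trace design_mxS batch_trace ?design_sym //; [lra|exact: lam_min_ge2].
Qed.

Lemma lam_max_trace s : lam_max s <= design_trace s <= 3 * lam_max s.
Proof.
have sp := design_eig s; have l2 := lam_min_ge2 s.
rewrite /design_trace (mxtrace_spectral sp) /lam_max; apply/andP; split.
  rewrite (bigD1 ord_max) //= lerDl sumr_ge0 // => i _.
  by apply: le_trans (eigval_ge_min sp i); apply: le_trans l2.
apply: (@le_trans _ _ (\sum_(i < 3) lam_max s)).
  by apply: ler_sum => i _; exact: eigval_le_max.
rewrite sumr_const card_ord -[lam_max s *+ 3]mulr_natr mulrC /lam_max. exact: lexx.
Qed.

Lemma lam_min_le_max s : lam_min s <= lam_max s.
Proof. exact/eigval_ge_min/design_eig. Qed.

Lemma sqrt_lam_max_sqr s : sqrt_lam_max s ^+ 2 = lam_max s.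
Proof. by rewrite sqr_sqrtr // (le_trans _ (lam_min_le_max s)) // (le_trans _ (lam_min_ge2 s)). Qed.

Lemma sqrt_lam_max_ge s : 7 / 5 <= sqrt_lam_max s.
Proof.
apply: le_trans sqrt2_ge _; rewrite /sqrt_lam_max ler_wsqrtr //.
exact: le_trans (lam_min_ge2 s) (lam_min_le_max s).
Qed.

Lemma lam_maxS_le s : lam_max s.+1 <= lam_max s + 4 * batch_weight s.
Proof.
rewrite /lam_max design_mxS.
have := batch_lmax heig (estimate s) (design_sym s) (batch_weight_ge0 s) (lam_min_ge2 s).
by move=> /le_trans; apply; rewrite lerD2l; lra.
Qed.

Lemma lam_minS_ge s (m : R) :
  m <= lam_min s + 2 * batch_weight s / (Num.sqrt (lam_min s) + 1) ^+ 2 -> m <= lam_max s -> m <= lam_min s.+1.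
Proof.
rewrite {3}/lam_min design_mxS => m1 m2.
by apply: batch_lmin => //; [exact: design_sym|exact: batch_weight_ge0|exact: lam_min_ge2].
Qed.

(** Induction from batch 1, where [lam_max <= 6]. One batch raises the target by at most
    [4/7 * 2 * mu]. Either [lam_min] is already above the new target, or it is small compared with
    [sqrt_lam_max], and then its guaranteed gain covers the rise. *)
Lemma lam_min_geS s : 4 / 7 * sqrt_lam_max s.+1 <= lam_min s.+1.
Proof.
have m0 := mu_gt0; have m1 := mu_le.
elim: s => [|s IH].
  have := lam_maxS_le 0; rewrite /batch_weight /= mulr1 => h1.
  have h0 : lam_max 0 <= 2.
    apply: (eigval_le (design_eig 0)) => y; by rewrite qform_scalar.
  have h2 : sqrt_lam_max 1 <= 5 / 2.
    have -> : 5 / 2 = Num.sqrt ((5 / 2) ^+ 2) :> R by rewrite sqrtr_sqr ger0_norm //; lra.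
    by rewrite /sqrt_lam_max ler_wsqrtr //; lra.
  have := lam_min_ge2 1; lra.
set l := lam_min s.+1 in IH *; set L := sqrt_lam_max s.+1 in IH *.
have L1 : 7 / 5 <= L := sqrt_lam_max_ge s.+1.
have l2 : 2 <= l := lam_min_ge2 s.+1.
have hL : sqrt_lam_max s.+2 <= L + 2 * mu.
  rewrite -[L + _]ger0_norm -?sqrtr_sqr; last lra.
  rewrite /sqrt_lam_max ler_wsqrtr //; apply: le_trans (lam_maxS_le s.+1) _.
  rewrite batch_weightS -sqrt_lam_max_sqr -/L; nra.
apply: le_trans (_ : 4 / 7 * (L + 2 * mu) <= _); first by rewrite ler_pM2l //; lra.
apply: lam_minS_ge; last by rewrite -sqrt_lam_max_sqr -/L; nra.
rewrite -/l batch_weightS -/L.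
set r := Num.sqrt l.
have r2 : r ^+ 2 = l by rewrite sqr_sqrtr //; lra.
have r0 : 7 / 5 <= r by apply: le_trans sqrt2_ge _; rewrite ler_wsqrtr.
have [hl|hl] := leP (4 / 7 * (L + 2 * mu)) l.
  apply: le_trans hl _; rewrite lerDl divr_ge0 ?sqr_ge0 //; nra.
have hd : 2 * mu * (4 / 7) <= 2 * (mu * L) / (r + 1) ^+ 2.
  rewrite ler_pdivlMr ?exprn_gt0 //; last lra.
  (* Here [r^2 < 4/7 * (L + 2 * mu)]. From [r >= 7/5] follows [r + 1 <= 12/7 * r], and [12/7 < 7/4]
     leaves room for [mu]. This is what admits the factor 4/7. *)
  have : 4 / 7 * (r + 1) ^+ 2 <= L by nra.
  nra.
lra.
Qed.

Lemma sqrt_trace_sqr s : sqrt_trace s ^+ 2 = design_trace s.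
Proof.
rewrite sqr_sqrtr //; have /andP[+ _] := lam_max_trace s; apply: le_trans.
by rewrite -sqrt_lam_max_sqr sqr_ge0.
Qed.

Lemma sqrt_trace_ge0 s : 0 <= sqrt_trace s. Proof. exact: sqrtr_ge0. Qed.

(** The trace is at most three times the top eigenvalue, and 4/7 is a rational lower bound for
    [1 / sqrt 3]. *)
Lemma sqrt_lam_max_trace s : 4 / 7 * sqrt_trace s <= sqrt_lam_max s <= sqrt_trace s.
Proof.
have /andP[h1 h2] := lam_max_trace s; move: h1 h2; rewrite -sqrt_lam_max_sqr -sqrt_trace_sqr => h1 h2.
have L0 := sqrt_lam_max_ge s; have H0 := sqrt_trace_ge0 s.
apply/andP; split.
  rewrite -(@ler_sqr _ _ (sqrt_lam_max s)) ?nnegrE; nra.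
by rewrite -ler_sqr ?nnegrE //; lra.
Qed.

(** The trace grows by [4 * mu * sqrt_lam_max], so its square root grows by at least [mu] and at
    most [2 * mu] per batch. After the first batch, of weight 1, the trace is 10, which lies between
    [(3 + mu)^2] and [(13/4)^2]. *)
Lemma sqrt_trace_bounds s : 3 + mu * s.+1%:R <= sqrt_trace s.+1 <= 3 + 2 * mu * s.+1%:R + 1 / 4 .
Proof.
have m0 := mu_gt0; have m1 := mu_le.
elim: s => [|s /andP[IH1 IH2]].
  have := sqrt_trace_sqr 1; rewrite design_traceS design_trace0 /batch_weight /= => h.
  have h0 := sqrt_trace_ge0 1; apply/andP; split; nra.
have := sqrt_trace_sqr s.+2; rewrite design_traceS batch_weightS -sqrt_trace_sqr => h.
have /andP[L1 L2] := sqrt_lam_max_trace s.+1; have h0 := sqrt_trace_ge0 s.+2; have h1 := sqrt_trace_ge0 s.+1.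
have n0 : 0 <= s.+1%:R :> R by rewrite ler0n.
have h3 : 3 <= sqrt_trace s.+1 by nra.
have e1 : sqrt_trace s.+1 + mu <= sqrt_trace s.+2.
  rewrite -ler_sqr ?nnegrE; [nra|lra|lra].
have e2 : sqrt_trace s.+2 <= sqrt_trace s.+1 + 2 * mu.
  rewrite -ler_sqr ?nnegrE; [nra|lra|lra].
rewrite -[s.+2%:R]natr1; apply/andP; split; lra.
Qed.

End Process.

(** * Median of means *)

Section MedianOfMeans.
Variables (R : realType) (k : nat) (med : seq R -> R) (argsel : seq R -> nat).
Hypothesis hmed : forall s : seq R, s != [::] -> is_median s (med s).
Hypothesis hargsel : forall s : seq R, s != [::] -> is_argmin s (argsel s).
Variables (D : nat -> nat -> R) (e : nat -> R) (rho : R).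
Hypothesis Dle : forall j l, D j l <= e j + e l.
Hypothesis Dge : forall j l, e j <= D j l + e l.
Hypothesis k2 : (2 <= k)%N.
Let bad := count (fun j => rho < e j) (iota 0 k).
Hypothesis few : (3 * bad < k)%N.
Let others j := [seq l <- iota 0 k | l != j].
Let y j := med [seq D j l | l <- others j].
Let jstar := argsel [seq y j | j <- iota 0 k].

Lemma size_others j : (j < k)%N -> size (others j) = k.-1.
Proof.
move=> jk; rewrite /others size_filter.
have := count_predC (fun l => l != j) (iota 0 k).
have -> : count (predC (fun l => l != j)) (iota 0 k) = 1%N.
  have -> : 1%N = count_mem j (iota 0 k).
    by rewrite count_uniq_mem ?iota_uniq // mem_iota jk.
  by apply: eq_count => l; rewrite /= negbK.
by rewrite size_iota addn1 => /(congr1 predn) <-.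
Qed.

Lemma count_others_bad (a : pred nat) j :
  (forall l, a l -> rho < e l) -> (count a (others j) <= bad)%N.
Proof.
move=> h; rewrite /others count_filter /bad.
by apply: sub_count => l /= /andP[/h].
Qed.

(** A score above [2 * rho] would put at least half of the other samples beyond [2 * rho] from a
    good one, hence make them bad; that is too many when fewer than a third are bad. *)
Lemma median_good j : (j < k)%N -> e j <= rho -> y j <= 2 * rho.
Proof.
move=> jk ej; rewrite leNgt; apply/negP => lt.
have s0 : [seq D j l | l <- others j] != [::].
  by rewrite -size_eq0 size_map size_others //; lia.
have [_] := hmed s0; rewrite -/(y j) size_map size_others // count_map => h.
have hb l : y j <= D j l -> rho < e l by move=> hl; have := Dle j l; lra.
have h' : (k.-1 <= 2 * count (fun l => y j <= D j l)%R (others j))%N := h.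
have := count_others_bad j hb; move: h' few k2; rewrite /=.
by move: (count _ (others j)) bad => a b; lia.
Qed.

(** Some sample is good, so the minimal score is at most [2 * rho]. At least half of the others lie
    within it of the chosen sample, and they cannot all be bad; a good one among them gives
    [3 * rho]. *)
Lemma mom_argmin : (jstar < k)%N /\ e jstar <= 3 * rho.
Proof.
have nz : [seq y j | j <- iota 0 k] != [::].
  by rewrite -size_eq0 size_map size_iota; lia.
have [] := hargsel nz; rewrite size_map size_iota -/jstar => jk hmin; split=> //.
have [j jk' ej] : exists2 j, (j < k)%N & e j <= rho.
  have : has (predC (fun j => rho < e j)) (iota 0 k).
    rewrite has_count -(ltn_add2l bad) /bad count_predC size_iota addn0 -/bad; lia.
  by case/hasP => j; rewrite mem_iota /= => jk'; rewrite -leNgt; exists j.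
have yj := median_good jk' ej.
have ys : y jstar <= 2 * rho.
  apply: le_trans yj; have := hmin j jk'.
  by rewrite !(nth_map 0%N) ?size_iota // !nth_iota.
have s0 : [seq D jstar l | l <- others jstar] != [::].
  by rewrite -size_eq0 size_map size_others //; lia.
have [+ _] := hmed s0; rewrite -/(y jstar) size_map size_others // count_map => h.
have [/hasP[l _ /andP[/= l1 l2]]|hn] :=
    boolP (has (fun l => (D jstar l <= y jstar) && (e l <= rho)) (others jstar)).
  by have := Dge jstar l; lra.
have hb l : ~~ (e l <= rho) -> rho < e l by rewrite ltNge.
have := count_others_bad jstar hb.
have : (count (fun l => D jstar l <= y jstar)%R (others jstar) <=
        count (fun l => ~~ (e l <= rho)%R) (others jstar))%N.
  have hs : {in others jstar, forall l, D jstar l <= y jstar -> ~~ (e l <= rho)}.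
    move=> l lo h1; apply: contraNN hn => h2; apply/hasP; exists l => //.
    by rewrite h1.
  elim: (others jstar) hs => //= a s IH hs.
  apply: leq_add; last by apply: IH => l ls; apply: hs; rewrite inE ls orbT.
  by have := hs a (mem_head _ _); case: (D _ _ <= _) => // /(_ isT) ->.
have h' : (k.-1 <= 2 * count (fun l => D jstar l <= y jstar)%R (others jstar))%N := h.
move: h' few k2 => {h}; move: bad (count _ (others _)) (count _ (others _)) => b a1 a2; lia.
Qed.

End MedianOfMeans.

(** * Blocks and noise *)

Section Blocks.
Variables (R : realType) (k : nat) (eigf : 'M[R]_3 -> 'M[R]_3)
  (med : seq R -> R) (argsel : seq R -> nat) (theta0 : 'cV[R]_3).
Hypothesis heig : forall V, V^T = V -> eig_spec V (eigf V).
Variables (theta : 'cV[R]_3) (x : nat -> bool).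
Hypothesis theta1 : dot theta theta = 1.

Local Notation VV := (design_mx k eigf med argsel theta0 x).
Local Notation that := (estimate k eigf med argsel theta0 x).
Local Notation bb := (moment_vec k eigf med argsel theta0 x).
Local Notation wt := (batch_weight k eigf med argsel theta0 x).

(* A block is the run of [k] consecutive rounds playing one action, the [j]-th of which feeds
   subsample [j]; batch [s] (0-based) consists of the blocks [4 * s .. 4 * s + 3]. *)
Definition block_action b := action eigf (VV (b %/ 4)%N) (that (b %/ 4)%N)
  ((b %% 4) %% 2 == 0)%N (inord ((b %% 4) %/ 2)).
Definition block_weight b := wt (b %/ 4)%N.
Definition block_mean b := dot theta (block_action b).
Definition block_reward j b : R := 2 * (x (b * k + j)%N)%:R - 1.
Definition block_noise j b := (block_weight b * (block_reward j b - block_mean b)) *: block_action b.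
(* The first batch has weight 1, too large for the variance bound of later batches; it is
   left out here and bounded outright in [initial_bias]. *)
Definition noise_sum j b := \sum_(4 <= c < b) block_noise j c.
Definition shifted_gram F b := F + \sum_(0 <= c < b) block_weight c *: (block_action c *m (block_action c)^T).

Lemma block_action_unit b : dot (block_action b) (block_action b) = 1.
Proof.
by apply: action_unit; [exact: design_eig|exact: lam_min_ge2].
Qed.

Lemma block_weight_ge0 b : 0 <= block_weight b.
Proof. exact: batch_weight_ge0. Qed.

Lemma block_mean_sqr b : block_mean b ^+ 2 <= 1.
Proof. by have := cauchy_schwarz theta (block_action b); rewrite theta1 block_action_unit mulr1. Qed.

Lemma block_mean_bounds b : -1 <= block_mean b <= 1.
Proof. by have := block_mean_sqr b; move=> h; apply/andP; split; nra. Qed.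

Lemma moment_vecS s j : bb s.+1 j = bb s j + wt s *: \sum_(i < 2)
  ((2 * (x (round_of (n := 1) k s.+1 i true j))%:R - 1) *: action eigf (VV s) (that s) true i +
   (2 * (x (round_of (n := 1) k s.+1 i false j))%:R - 1) *: action eigf (VV s) (that s) false i).
Proof.
rewrite /bb /moment_vec /batch_weight /design_mx /estimate /bandit_state /=.
by case: (lstate _ _ _ _ _ _ _ s) => [[V b] th].
Qed.

Definition sample_estimate s j := invmx (VV s) *m bb s j.

Definition scores (V : 'M[R]_3) (e : nat -> 'cV[R]_3) : seq R :=
  [seq med [seq Vnorm V (e j - e l) | l <- iota 0 k & l != j] | j <- iota 0 k].

Lemma estimateS s : that s.+1 = sample_estimate s.+1 (argsel (scores (VV s.+1) (sample_estimate s.+1))).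
Proof.
rewrite /sample_estimate /moment_vec /design_mx /estimate /bandit_state /=.
by case: (lstate _ _ _ _ _ _ _ s) => [[V b] th].
Qed.

Lemma sum_batch (T : nmodType) (F : nat -> T) s :
  \sum_(0 <= c < 4 * s.+1) F c = \sum_(0 <= c < 4 * s) F c
    + (F (4 * s)%N + F (4 * s + 1)%N + F (4 * s + 2)%N + F (4 * s + 3)%N).
Proof.
have -> : (4 * s.+1 = (4 * s + 3).+1)%N by lia.
rewrite big_nat_recr //= addnS big_nat_recr //= addnS big_nat_recr //= addnS addn0.
by rewrite big_nat_recr //= ?addnS ?addn0 !addrA.
Qed.

Lemma block_index s r : (r < 4)%N -> ((4 * s + r) %/ 4 = s /\ (4 * s + r) %% 4 = r)%N.
Proof. move=> r4; split; lia. Qed.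

Lemma inord0 : inord 0 = ord0 :> 'I_2.
Proof. by apply: val_inj; rewrite /= inordK. Qed.

Lemma inord1 : inord 1 = lift ord0 ord0 :> 'I_2.
Proof. by apply: val_inj; rewrite /= inordK. Qed.

Lemma block_actionE s : [/\ block_action (4 * s) = action eigf (VV s) (that s) true ord0,
  block_action (4 * s + 1) = action eigf (VV s) (that s) false ord0,
  block_action (4 * s + 2) = action eigf (VV s) (that s) true (lift ord0 ord0) &
  block_action (4 * s + 3) = action eigf (VV s) (that s) false (lift ord0 ord0)].
Proof.
have h r : (r < 4)%N -> block_action (4 * s + r) =
    action eigf (VV s) (that s) (r %% 2 == 0)%N (inord (r %/ 2)).
  by move=> /(@block_index s)[e1 e2]; rewrite /block_action e1 e2.
split; [rewrite -[(4 * s)%N]addn0 | | | ]; by rewrite h // ?inord0 ?inord1.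
Qed.

Lemma block_weightE s r : (r < 4)%N -> block_weight (4 * s + r) = wt s.
Proof. by move=> /(@block_index s)[]; rewrite /block_weight => ->. Qed.

Lemma design_blocks s : VV s = 2%:M + \sum_(0 <= c < 4 * s) block_weight c *: (block_action c *m (block_action c)^T).
Proof.
elim: s => [|s IH]; first by rewrite muln0 big_geq // addr0.
rewrite design_mxS // {1}IH sum_batch -[X in block_weight X *: _]addn0 !block_weightE //.
have [-> -> -> ->] := block_actionE s.
rewrite -[LHS]addrA; congr (_ + _); congr (_ + _).
rewrite /batch_gram; move: (action eigf (VV s) (that s)) => A.
by rewrite -3!scalerDr 2!big_ord_recl big_ord0 addr0 !addrA.
Qed.

Lemma moment_blocks s j : bb s j = \sum_(0 <= c < 4 * s) (block_weight c * block_reward j c) *: block_action c.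
Proof.
elim: s => [|s IH]; first by rewrite muln0 big_geq.
rewrite moment_vecS // {1}IH sum_batch -[X in block_weight X * _]addn0 !block_weightE //.
have [-> -> -> ->] := block_actionE s.
have e (i : 'I_2) (sg : bool) r : (r = 2 * i + if sg then 0 else 1)%N ->
    block_reward j (4 * s + r) = 2 * (x (round_of (n := 1) k s.+1 i sg j))%:R - 1.
  move=> ->; rewrite /block_reward /round_of /batch_len /=; congr (2 * (x _)%:R - 1).
  lia.
rewrite -[X in block_reward j X]addn0.
rewrite (e ord0 true) // (e ord0 false) // (e (lift ord0 ord0) true) // (e (lift ord0 ord0) false) //.
move: (action eigf (VV s) (that s)) => A.
by rewrite -!scalerA -!scalerDr 2!big_ord_recl big_ord0 addr0 !addrA.
Qed.

(** The normal equations with each reward split into mean and noise. The term in [theta] is the bias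
    of the regularizer [2%:M]; it is grouped with the noise of the first batch because both are
    bounded outright. *)
Lemma residual_blocks s j :
  bb s.+1 j - VV s.+1 *m theta = - 2 *: theta + \sum_(0 <= c < 4) block_noise j c + noise_sum j (4 * s.+1).
Proof.
have e : \sum_(0 <= c < 4 * s.+1) block_noise j c = \sum_(0 <= c < 4) block_noise j c + noise_sum j (4 * s.+1).
  by rewrite /noise_sum -big_cat_nat //; lia.
rewrite -addrA -e moment_blocks design_blocks mulmxDl mul_scalar_mx opprD addrCA scaleNr; congr (_ + _).
rewrite mulmx_suml -sumrB; apply: eq_bigr => c _.
rewrite -scalemxAl rank1_mul /block_noise [dot (block_action c) theta]dotC -/(block_mean c).
by move: (block_action c) => a; rewrite scalerA -scalerBl -mulrBr.
Qed.

Lemma block_noise_vnorm j c : (c < 4)%N -> vnorm (block_noise j c) <= 2.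
Proof.
move=> c4; rewrite /block_noise vnormZ vnormE block_action_unit sqrtr1 mulr1.
rewrite /block_weight divn_small // /batch_weight /= mul1r.
have /andP[m1 m2] := block_mean_bounds c.
rewrite /block_reward; case: (x _) => /=; rewrite ler_norml; lra.
Qed.

Lemma initial_bias j : vnorm (- 2 *: theta + \sum_(0 <= c < 4) block_noise j c) <= 10.
Proof.
apply: le_trans (vnormD _ _) _.
have h1 : vnorm (- 2 *: theta) <= 2.
  by rewrite vnormZ vnormE theta1 sqrtr1 mulr1 normrN ger0_norm.
have h2 : vnorm (\sum_(0 <= c < 4) block_noise j c) <= 8.
  have four (a b c d : 'cV[R]_3) : vnorm a <= 2 -> vnorm b <= 2 -> vnorm c <= 2 ->
      vnorm d <= 2 -> vnorm (a + (b + (c + d))) <= 8.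
    have := vnormD a (b + (c + d)); have := vnormD b (c + d); have := vnormD c d; lra.
  by rewrite !big_nat_recl // big_geq // addr0; apply: four; exact: block_noise_vnorm.
lra.
Qed.

End Blocks.

(** * Good histories *)

Section DualEstimate.
Variables (R : realType) (n : nat) (V Q : 'M[R]_n.+2) (y : 'cV[R]_n.+2).
Hypotheses (cV : coercive V) (sp : eig_spec V Q) (y1 : dot y y = 1).

Lemma qform_inv_spectral : qform (invmx V) y = \sum_i dot (col i Q) y ^+ 2 / eigval V Q i.
Proof.
have [sV _] := cV.
rewrite -qform_inv // (qform_spectral sV sp); apply: eq_bigr => i _.
have e := coord_mul sV sp i (invmx V *m y).
rewrite mulKVmx ?coercive_unit // in e.
have l0 := eigval_gt0 sp cV i.
by rewrite e exprMn; field; rewrite gt_eqF.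
Qed.

(* The mass of [V] orthogonal to [y] controls the angle between [y] and the top eigenvector. *)
Lemma qform_inv_le_mass :
  qform (invmx V) y <=
  (1 + (\tr V - qform V y) / eigval V Q ord0) / eigval V Q ord_max.
Proof.
have [sV _] := cV.
have l0 := eigval_gt0 sp cV.
have sum1 : \sum_i dot (col i Q) y ^+ 2 = 1.
  by rewrite -y1 (dot_spectral sp); apply: eq_bigr => i _; rewrite expr2.
have le1 i : dot (col i Q) y ^+ 2 <= 1.
  by rewrite -sum1 (bigD1 i) //= lerDl sumr_ge0 // => j _; rewrite sqr_ge0.
have mass : eigval V Q ord_max * (1 - dot (col ord_max Q) y ^+ 2) <= \tr V - qform V y.
  rewrite (mxtrace_spectral sp) (qform_spectral sV sp) -sumrB (bigD1 ord_max) //=.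
  rewrite mulrBr mulr1 lerDl sumr_ge0 // => i _.
  by rewrite -[X in X - _]mulr1 -mulrBr mulr_ge0 ?subr_ge0 // ltW.
have h : qform (invmx V) y <=
    dot (col ord_max Q) y ^+ 2 / eigval V Q ord_max +
    (1 - dot (col ord_max Q) y ^+ 2) / eigval V Q ord0.
  rewrite qform_inv_spectral (bigD1 ord_max) //= lerD2l.
  have -> : 1 - dot (col ord_max Q) y ^+ 2 = \sum_(i < n.+2 | i != ord_max) dot (col i Q) y ^+ 2.
    by rewrite -sum1 (bigD1 ord_max) //= addrC addrK.
  rewrite mulr_suml; apply: ler_sum => i _.
  by rewrite ler_wpM2l ?sqr_ge0 // lef_pV2 ?posrE ?eigval_ge_min.
apply: le_trans h _; move: (le1 ord_max) mass (l0 ord0) (l0 ord_max).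
move: (dot _ _ ^+ 2) (eigval V Q ord0) (eigval V Q ord_max) (_ - _) => t a b m t1 mass a0 b0.
rewrite mulrDl mul1r; apply: lerD; first by rewrite ler_pdivrMr // mulVf ?gt_eqF.
by rewrite ler_pdivlMr // mulrAC ler_wpM2r ?invr_ge0 ?(ltW a0) // mulrC.
Qed.

End DualEstimate.

Section Splitting.
Variables (R : realType) (n : nat) (y : 'cV[R]_n).
Hypothesis y1 : dot y y = 1.

(** For a unit vector [y] this is [a] along [y] and [b] on its complement, so products, inverses and
    square roots are taken coefficientwise. *)
Definition split_mx (a b : R) : 'M[R]_n := a *: (y *m y^T) + b *: (1%:M - y *m y^T).

Lemma split_mx_mul a b v : split_mx a b *m v = (a * dot y v) *: y + b *: (v - dot y v *: y).
Proof. by rewrite /split_mx mulmxDl -!scalemxAl mulmxBl rank1_mul mul1mx scalerA. Qed.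

Lemma split_mxM a b c d : split_mx a b *m split_mx c d = split_mx (a * c) (b * d).
Proof.
have yy : (y *m y^T) *m (y *m y^T) = y *m y^T.
  by rewrite mulmxA rank1_mul y1 scale1r.
rewrite /split_mx mulmxDl !mulmxDr -!scalemxAl -!scalemxAr !mulmxBl !mulmxBr !mul1mx !mulmx1 yy.
by rewrite !subrr !subr0 !scaler0 addr0 add0r !scalerA.
Qed.

Lemma split_mx1 : split_mx 1 1 = 1%:M.
Proof. by rewrite /split_mx !scale1r addrC subrK. Qed.

Lemma split_mx_sym a b : (split_mx a b)^T = split_mx a b.
Proof.
by rewrite /split_mx linearD !linearZ /= linearB /= rank1_sym trmx1.
Qed.

Lemma qform_split a b v : qform (split_mx a b) v = a * dot y v ^+ 2 + b * (dot v v - dot y v ^+ 2).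
Proof. by rewrite /qform split_mx_mul !dot_lin [dot v y]dotC; ring. Qed.

Lemma split_coercive a b : 0 < a -> 0 < b -> coercive (split_mx a b).
Proof.
move=> a0 b0; split; first exact: split_mx_sym.
exists (Num.min a b); first by rewrite lt_min a0.
move=> v; rewrite qform_split.
have h := cauchy_schwarz y v; rewrite y1 mul1r in h.
have h1 : Num.min a b <= a by rewrite ge_min lexx.
have h2 : Num.min a b <= b by rewrite ge_min lexx orbT.
have h3 := sqr_ge0 (dot y v).
move: (Num.min a b) h1 h2 => m h1 h2.
have := ler_wpM2r h3 h1; rewrite -subr_ge0 in h; have := ler_wpM2r h h2; lra.
Qed.

End Splitting.

Section GoodEvent.
Variables (R : realType) (k : nat) (eigf : 'M[R]_3 -> 'M[R]_3)
  (med : seq R -> R) (argsel : seq R -> nat) (theta0 : 'cV[R]_3).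
Hypothesis heig : forall V, V^T = V -> eig_spec V (eigf V).
Variables (theta : 'cV[R]_3) (x : nat -> bool).
Hypothesis theta1 : dot theta theta = 1.

Local Notation VV := (design_mx k eigf med argsel theta0 x).
Local Notation that := (estimate k eigf med argsel theta0 x).
Local Notation wt := (batch_weight k eigf med argsel theta0 x).
Local Notation lmin := (lam_min k eigf med argsel theta0 x).
Local Notation lmax := (lam_max k eigf med argsel theta0 x).
Local Notation Lam := (sqrt_lam_max k eigf med argsel theta0 x).
Local Notation tau := (design_trace k eigf med argsel theta0 x).
Local Notation hh := (sqrt_trace k eigf med argsel theta0 x).
Local Notation blk_w := (block_weight k eigf med argsel theta0 x).
Local Notation blk_mean := (block_mean k eigf med argsel theta0 theta x).

(* Below [small_scale] the weight [mu * Lam r] is at most [noise_level] whatever the estimate.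
   Above it, the radius 30 makes weight times variance at most [noise_level] (see
   [variance_arith]), and it is what median of means returns, because
   [3 * (sqrt (6 / 5 * 256 * noise_level) + 10 / 33) <= 30]. *)
Definition small_scale : R := 20 * 100.
Definition noise_level : R := mu R * small_scale.

Definition good_batch r : bool := (Lam r <= small_scale) || (Vnorm (VV r) (that r - theta) <= 30).

Lemma noise_level_gt0 : 0 < noise_level.
Proof. by rewrite mulr_gt0 ?mu_gt0 // /small_scale; lra. Qed.

Lemma noise_level_le : noise_level * 15 <= 4.
Proof. have := mu_le R; rewrite /noise_level /small_scale; lra. Qed.

Section Large.
Variable r : nat.
Hypotheses (r0 : (0 < r)%N) (hL : small_scale < Lam r).

Lemma lam_min_ge_sqrt_max : 4 / 7 * Lam r <= lmin r.
Proof. by case: r r0 => // r' _; apply: lam_min_geS. Qed.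

Lemma sqrt_lmin_ge : 33 <= Num.sqrt (lmin r).
Proof.
(* [4/7 * 2000] exceeds [33^2 = 1089]. *)
have -> : 33 = Num.sqrt (33 ^+ 2) :> R by rewrite sqrtr_sqr ger0_norm //; lra.
rewrite ler_wsqrtr //; have := lam_min_ge_sqrt_max; have := hL; rewrite /small_scale; lra.
Qed.

Lemma near_target : Vnorm (VV r) (that r - theta) <= 30 ->
  lmin r * dot (that r - theta) (that r - theta) <= 30 ^+ 2.
Proof.
move=> h; have sV := design_sym k eigf med argsel theta0 x r.
have sp := design_eig k med argsel theta0 heig x r.
apply: le_trans (qform_ge_min sV sp _) _.
have V0 := coercive_ge0 (that r - theta) (design_coercive k eigf med argsel theta0 x r).
rewrite -(sqr_sqrtr V0) -VnormE ler_sqr ?nnegrE ?Vnorm_ge0 //; lra.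
Qed.

Lemma lmin_gt : 30 ^+ 2 < lmin r.
Proof. have := lam_min_ge_sqrt_max; have := hL; rewrite /small_scale; lra. Qed.

End Large.

Lemma variance_arith (v l L : R) : 0 <= L -> 4 / 7 * L <= l -> 33 <= v -> v ^+ 2 = l ->
  L * ((30 + 1) / (v - 1)) ^+ 2 <= small_scale.
Proof.
move=> L0 lL v33 v2; rewrite -v2 in lL.
rewrite exprMn exprVn mulrA ler_pdivrMr ?exprn_gt0 //; last lra.
(* Since [31/33 = 1 - 2/33]. The left side of the claim is then at most [7/4 * 31^2 * 33/31], about
   1790, which [small_scale] has to dominate. *)
have : 31 / 33 * v ^+ 2 <= (v - 1) ^+ 2.
  have : 0 <= v * (v - 33) by apply: mulr_ge0; lra.
  lra.
rewrite /small_scale; lra.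
Qed.

Lemma good_variance r sg i : (0 < r)%N -> good_batch r ->
  wt r * (1 - dot theta (action eigf (VV r) (that r) sg i) ^+ 2) <= noise_level.
Proof.
case: r => // r _; have m0 := mu_gt0 R.
have L0 := sqrt_lam_max_ge k med argsel theta0 heig x r.+1.
have sV := design_sym k eigf med argsel theta0 x r.+1.
have sp := design_eig k med argsel theta0 heig x r.+1.
have l2 := lam_min_ge2 k med argsel theta0 heig x r.+1.
rewrite batch_weightS /noise_level -mulrA ler_pM2l //.
have [hL _|hL] := leP (Lam r.+1) small_scale.
  apply: le_trans hL; rewrite ler_piMr //; first lra.
  by rewrite lerBlDr lerDl sqr_ge0.
rewrite /good_batch leNgt hL /= => /(near_target).
have := lmin_gt (isT : (0 < r.+1)%N) hL.
have := lam_min_ge_sqrt_max (isT : (0 < r.+1)%N); have s33 := sqrt_lmin_ge (isT : (0 < r.+1)%N) hL.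
move=> lL l900 hB.
rewrite dotC; have := action_variance sp l2 theta1 _ l900 hB sg i.
move=> /(_ (ler0n _ _)); rewrite -[eigval _ _ _]/(lmin r.+1) => hv.
apply: le_trans (ler_wpM2l _ hv) _; first lra.
apply: variance_arith lL s33 _; first lra.
by rewrite sqr_sqrtr // (le_trans _ l2).
Qed.

Lemma good_regret r sg i : (0 < r)%N -> good_batch r -> small_scale < Lam r ->
  1 - dot theta (action eigf (VV r) (that r) sg i) <= 2 * (2 * 30 + 1) ^+ 2 / lmin r.
Proof.
move=> r0 + hL; rewrite /good_batch leNgt hL /= => /(near_target) hB.
have sp := design_eig k med argsel theta0 heig x r.
have l2 := lam_min_ge2 k med argsel theta0 heig x r.
by rewrite dotC; apply: action_regret => //; exact: lmin_gt.
Qed.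

(** Weight times variance, summed over the blocks, is also the trace of the design across [theta] up
    to the regularizer: control of the noise is control of the geometry. *)
Definition transverse_mass s := \sum_(0 <= c < 4 * s) blk_w c * (1 - blk_mean c ^+ 2).

Lemma trace_blocks s : tau s = 6 + \sum_(0 <= c < 4 * s) blk_w c.
Proof.
rewrite /design_trace design_blocks // mxtraceD mxtrace_scalar linear_sum /=.
congr (_ + _); first by rewrite -mulr_natr; lra.
apply: eq_bigr => c _.
by rewrite linearZ /= mxtrace_rank1 block_action_unit // mulr1.
Qed.

Lemma qform_blocks s : qform (VV s) theta = 2 + \sum_(0 <= c < 4 * s) blk_w c * blk_mean c ^+ 2.
Proof.
rewrite design_blocks // qformDl qform_scalar theta1 mulr1 qform_suml; congr (_ + _).
by apply: eq_bigr => c _; rewrite qformZl qform_rank1 dotC.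
Qed.

Lemma transverse_mass_trace s : tau s - qform (VV s) theta = 4 + transverse_mass s.
Proof.
rewrite trace_blocks qform_blocks /transverse_mass.
under [X in _ = _ + X]eq_bigr do rewrite mulrBr mulr1.
rewrite sumrB; lra.
Qed.

Section History.
Variables (s : nat).
Hypothesis hgood : forall r, (0 < r < s)%N -> good_batch r.

Lemma block_variance c : (4 <= c < 4 * s)%N -> blk_w c * (1 - blk_mean c ^+ 2) <= noise_level.
Proof.
move=> /andP[c4 cs]; apply: good_variance; first by rewrite divn_gt0.
apply: hgood; rewrite divn_gt0 // c4 /= ltn_divLR // mulnC //.
Qed.

Lemma transverse_mass_le : (0 < s)%N -> transverse_mass s <= 4 + 4 * (s.-1)%:R * noise_level.
Proof.
move=> s0; rewrite /transverse_mass (big_cat_nat (n := 4)) //=; last by lia.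
apply: lerD.
  apply: (@le_trans _ _ (\sum_(0 <= c < 4) (1 : R))).
    rewrite !big_mkord; apply: ler_sum => c _.
    rewrite /block_weight divn_small // /batch_weight /= mul1r lerBlDr lerDl sqr_ge0 //.
  by rewrite big_mkord sumr_const card_ord.
apply: (@le_trans _ _ (\sum_(4 <= c < 4 * s) noise_level)).
  by rewrite big_nat_cond [leRHS]big_nat_cond; apply: ler_sum => c /andP[hc _]; exact: block_variance.
have e : (4 * s - 4 = 4 * s.-1)%N by lia.
rewrite sumr_const_nat e -[leLHS]mulr_natl. by rewrite natrM.
Qed.

(** Both sides are compared through bounds linear in [s]: per batch the mass gains at most
    [4 * small_scale * mu], and the lower bound for the root of the trace gains [mu]. *)
Lemma transverse_mass_sqrt_trace : (0 < s)%N -> 4 + transverse_mass s <= 4 * small_scale * hh s.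
Proof.
move=> s0; apply: le_trans (lerD (lexx _) (transverse_mass_le s0)) _.
have := sqrt_trace_bounds k med argsel theta0 heig x s.-1.
rewrite prednK // => /andP[h1 _].
have : s.-1%:R + 1 = s%:R :> R by rewrite natr1 prednK.
move: h1; move: (mu_gt0 R); rewrite /noise_level /small_scale; move: (s.-1)%:R (hh s) (s%:R) (mu R) => a h b m m0 h1 ab.
rewrite -ab in h1; nra.
Qed.

(** In [qform_inv_le_mass] the transverse mass and the smallest eigenvalue are both compared with
    the root of the trace, so their ratio is bounded and [theta] behaves like the top
    eigenvector. *)
Lemma inv_theta_le : (0 < s)%N -> qform (invmx (VV s)) theta * hh s ^+ 2 <= 38 * small_scale.
Proof.
move=> s0.
have cV := design_coercive k eigf med argsel theta0 x s.
have sp := design_eig k med argsel theta0 heig x s.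
have := qform_inv_le_mass cV sp theta1; rewrite -/(tau s) transverse_mass_trace.
rewrite -/(lmin s) -/(lmax s) -(sqrt_lam_max_sqr k med argsel theta0 heig x).
have lL := lam_min_ge_sqrt_max s0; have m := transverse_mass_sqrt_trace s0.
have /andP[h1 h2] := sqrt_lam_max_trace k med argsel theta0 heig x s.
have L0 := sqrt_lam_max_ge k med argsel theta0 heig x s.
have l2 := lam_min_ge2 k med argsel theta0 heig x s.
move: (qform _ _) (4 + transverse_mass s) (lmin s) (Lam s) (hh s) lL m h1 h2 L0 l2
  => p M l L h lL m h1 h2 L0 l2 hp.
have h0 : 0 < h by lra.
(* [M <= 4 * small_scale * h], [h <= 7/4 * L] and [L <= 7/4 * l] give [4 * 49/16]. Passing from
   [L^2] to [h^2] costs another 49/16, and the product is just below [38 * small_scale]. *)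
have e1 : (1 + M / l) <= 1 + 49 / 4 * small_scale.
  rewrite lerD2l ler_pdivrMr; last lra.
  rewrite /small_scale in m *; nra.
have e2 : p * L ^+ 2 <= 1 + 49 / 4 * small_scale.
  apply: le_trans e1; rewrite -ler_pdivlMr ?exprn_gt0 //; lra.
have e3 : h ^+ 2 <= 49 / 16 * L ^+ 2 by nra.
have [p0|p0] := leP p 0.
  by apply: (@le_trans _ _ 0); [nra|rewrite /small_scale; lra].
have := ler_wpM2l (ltW p0) e3; rewrite /small_scale in e2 *; nra.
Qed.

End History.
End GoodEvent.

Section ExpBounds.
Variables (R : realType).

Lemma exp16_ge : (13 * 100 * 1000 : R) <= expR 16.
Proof.
have h : (5 / 4 : R) <= expR (1 / 4) by apply: le_trans (expR_ge1Dx _); lra.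
have h4 : (244 / 100 : R) <= expR 1.
  have -> : expR 1 = expR (1 / 4) ^+ 4 :> R by rewrite -expRM_natr; congr expR; field.
  apply: (@le_trans _ _ ((5 / 4) ^+ 4)); first lra.
  by rewrite lerXn2r ?nnegrE ?expR_ge0 //; lra.
have sq (a b : R) : 0 <= a -> a <= expR b -> a ^+ 2 <= expR (b *+ 2).
  by move=> a0 ab; rewrite -mulr_natr expRM_natr lerXn2r ?nnegrE ?expR_ge0.
have h8 : (595 / 100 : R) <= expR (1 *+ 2) by apply: le_trans (sq _ _ _ h4); lra.
have h16 : (354 / 10 : R) <= expR (1 *+ 2 *+ 2) by apply: le_trans (sq _ _ _ h8); lra.
have h32 : (1253 : R) <= expR (1 *+ 2 *+ 2 *+ 2) by apply: le_trans (sq _ _ _ h16); lra.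
apply: le_trans (_ : expR (1 *+ 2 *+ 2 *+ 2 *+ 2) <= _); last by rewrite -!mulrnA.
apply: le_trans (sq _ _ _ h32); lra.
Qed.

Lemma exp_half_le : expR (1 / 2) <= 5 / 3 :> R.
Proof.
(* 32 is the first power of two fine enough: [(16/15)^8] already exceeds 5/3. *)
have h : (31 / 32 : R) <= expR (- (1 / 32)) by apply: le_trans (expR_ge1Dx _); lra.
have h1 : expR (1 / 32) <= 32 / 31 :> R.
  rewrite -[expR _]invrK -expRN -[32 / 31]invrK lef_pV2 ?posrE ?expR_gt0 //; lra.
have -> : expR (1 / 2) = expR (1 / 32) ^+ 16 :> R by rewrite -expRM_natr; congr expR; field.
apply: (@le_trans _ _ ((32 / 31) ^+ 16)).
  by rewrite lerXn2r ?nnegrE ?expR_ge0 //; lra.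
lra.
Qed.

End ExpBounds.

(** * The reference matrix and the determinant bound *)

Section Reference.
Variables (R : realType) (k : nat) (eigf : 'M[R]_3 -> 'M[R]_3)
  (med : seq R -> R) (argsel : seq R -> nat) (theta0 : 'cV[R]_3).
Hypothesis heig : forall V, V^T = V -> eig_spec V (eigf V).
Variables (theta : 'cV[R]_3) (x : nat -> bool).
Hypothesis theta1 : dot theta theta = 1.

Local Notation VV := (design_mx k eigf med argsel theta0 x).
Local Notation lmin := (lam_min k eigf med argsel theta0 x).
Local Notation Lam := (sqrt_lam_max k eigf med argsel theta0 x).
Local Notation tau := (design_trace k eigf med argsel theta0 x).
Local Notation hh := (sqrt_trace k eigf med argsel theta0 x).
Local Notation blk_act := (block_action k eigf med argsel theta0 x).
Local Notation blk_w := (block_weight k eigf med argsel theta0 x).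
Local Notation blk_mean := (block_mean k eigf med argsel theta0 theta x).
Local Notation UU := (shifted_gram k eigf med argsel theta0 x).
Local Notation good := (good_batch k eigf med argsel theta0 theta x).
Local Notation mass := (transverse_mass k eigf med argsel theta0 theta x).

Lemma shifted_gram_sym F b : F^T = F -> (UU F b)^T = UU F b.
Proof.
move=> sF; rewrite /shifted_gram linearD /= sF linear_sum; congr (_ + _).
by apply: eq_bigr => c _; rewrite linearZ /= rank1_sym.
Qed.

Lemma shifted_gramS F b : UU F b.+1 = UU F b + blk_w b *: (blk_act b *m (blk_act b)^T).
Proof. by rewrite /shifted_gram big_nat_recr //= addrA. Qed.

Lemma shifted_gram_coercive F b : coercive F -> coercive (UU F b).
Proof.
move=> cF; elim: b => [|b IH]; first by rewrite /shifted_gram big_geq // addr0.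
by rewrite shifted_gramS; apply: coercive_rank1 => //; exact: block_weight_ge0.
Qed.

Lemma shifted_gram_design F s : UU F (4 * s) = VV s + (F - 2%:M).
Proof.
rewrite /shifted_gram design_blocks //; move: (\sum_(_ <= _ < _) _) => S.
by rewrite [2%:M + S]addrC -addrA [2%:M + _]addrC subrK addrC.
Qed.

(** A deterministic proxy, within a factor 2, for the path-dependent [sqrt_trace]. *)
Definition clock s : R := 3 + mu R * s%:R.
(* Deterministic, and below [design_mx s] on good histories. Starting the Gram matrix of the
   noise from it, instead of from [2%:M], bounds the total growth of [ln det] by 48 uniformly
   in [s] (an ordinary elliptical potential would grow like [ln s]). *)
Definition reference_mx s : 'M[R]_3 := split_mx theta (clock s ^+ 2 / (8 * 100 * 1000)) (clock s / 40).

Lemma clock_ge s : 3 <= clock s.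
Proof. by rewrite /clock lerDl mulr_ge0 // ltW // mu_gt0. Qed.

Lemma clock_sqrt_trace s : (0 < s)%N -> clock s <= hh s <= 2 * clock s.
Proof.
case: s => // s _; have /andP[h1 h2] := sqrt_trace_bounds k med argsel theta0 heig x s.
by rewrite /clock; apply/andP; split=> //; lra.
Qed.

Lemma reference_coef_gt0 s : 0 < clock s ^+ 2 / (8 * 100 * 1000) /\ 0 < clock s / 40.
Proof.
have g3 := clock_ge s; split; last lra.
by apply: divr_gt0; [rewrite exprn_gt0 //; lra|lra].
Qed.

Lemma reference_coercive s : coercive (reference_mx s).
Proof. by have [a0 b0] := reference_coef_gt0 s; apply: split_coercive. Qed.

Section History.
Variables (s : nat).
Hypothesis s0 : (0 < s)%N.
Hypothesis hgood : forall r, (0 < r < s)%N -> good r.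

(** Each of the two parts is at most a tenth of the design form, which fixes the denominators of
    [reference_mx]. Along [theta], dual Cauchy-Schwarz and [inv_theta_le] leave
    [38 * 2000 / 800000]; across, [clock <= 49/16 * lam_min] leaves [49/640]. *)
Lemma reference_le y : qform (reference_mx s) y <= 1 / 5 * qform (VV s) y.
Proof.
have cV := design_coercive k eigf med argsel theta0 x s.
have sp := design_eig k med argsel theta0 heig x s.
have sV := design_sym k eigf med argsel theta0 x s.
have h1' : dot theta y ^+ 2 <= qform (VV s) y * qform (invmx (VV s)) theta.
  by rewrite dotC; apply: dual_cauchy_schwarz.
have h2 := inv_theta_le heig theta1 hgood s0.
have h3 := qform_ge_min sV sp y; rewrite -[eigval _ _ _]/(lmin s) in h3.
have lL := lam_min_ge_sqrt_max k med argsel theta0 heig x s0.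
have /andP[L1 _] := sqrt_lam_max_trace k med argsel theta0 heig x s.
have /andP[g1 g2] := clock_sqrt_trace s0; have g3 := clock_ge s.
have V0 := coercive_ge0 y cV; have d0 := dot_ge0 y.
have i0 := qform_inv_ge0 theta cV.
rewrite /reference_mx qform_split //.
move: h1' h2 h3 lL L1 g1 g2 g3 V0 d0 i0.
move: (dot theta y) (dot y y) (qform (VV s) y) (qform (invmx _) _) (lmin s) (Lam s) (hh s) (clock s).
move=> d e v p l L h g h1 h2 h3 lL L1 g1 g2 g3 V0 d0 i0.
have le1 : g ^+ 2 / (8 * 100 * 1000) * d ^+ 2 <= 1 / 10 * v.
  have a1 : g ^+ 2 <= h ^+ 2 by rewrite ler_sqr ?nnegrE; lra.
  have a2 : p * g ^+ 2 <= 38 * small_scale R by apply: le_trans h2; rewrite ler_wpM2l.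
  have a3 := ler_wpM2l (sqr_ge0 g) h1.
  have a4 := ler_wpM2l V0 a2.
  rewrite mulrAC ler_pdivrMr; last lra.
  apply: le_trans a3 _.
  have -> : g ^+ 2 * (v * p) = v * (p * g ^+ 2) by ring.
  apply: le_trans a4 _; rewrite /small_scale; lra.
have le2 : g / 40 * (e - d ^+ 2) <= 1 / 10 * v.
  have b1 : g / 40 <= 49 / (16 * 40) * l by lra.
  have b2 : g / 40 * (e - d ^+ 2) <= g / 40 * e.
    by rewrite ler_wpM2l ?lerBlDr ?lerDl ?sqr_ge0 //; lra.
  have b3 := ler_wpM2r d0 b1; lra.
lra.
Qed.

Lemma shifted_gram_le y : qform (UU (reference_mx s) (4 * s)) y <= 6 / 5 * qform (VV s) y.
Proof.
have e : qform (- 2%:M) y = - (2 * dot y y).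
  by rewrite /qform mulNmx mul_scalar_mx dotNr dotZr.
rewrite shifted_gram_design [qform (VV s + _) y]qformDl [qform (reference_mx s + _) y]qformDl e.
have := reference_le y; have := dot_ge0 y; lra.
Qed.

(** Conjugating with the inverse square root [H] of the reference matrix turns the ratio of
    determinants into [\det X], which is at most the cube of a third of [\tr X]. The trace is the
    mass along [theta] over [a] plus the mass across over [b], plus 3. *)
Lemma det_shifted_gram_le : \det (UU (reference_mx s) (4 * s)) <= \det (reference_mx s) * expR 48.
Proof.
have [a0 b0] := reference_coef_gt0 s.
set a := (X in 0 < X) in a0; set b := (X in 0 < X) in b0.
pose H := split_mx theta (Num.sqrt a)^-1 (Num.sqrt b)^-1.
have sa : Num.sqrt a ^+ 2 = a by rewrite sqr_sqrtr // ltW.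
have sb : Num.sqrt b ^+ 2 = b by rewrite sqr_sqrtr // ltW.
have ra : 0 < Num.sqrt a by rewrite sqrtr_gt0.
have rb : 0 < Num.sqrt b by rewrite sqrtr_gt0.
have HFH : H *m reference_mx s *m H = 1%:M.
  rewrite /H /reference_mx -/a -/b !split_mxM // -(split_mx1 theta); congr split_mx.
    by rewrite -{2}sa; field; rewrite gt_eqF.
  by rewrite -{2}sb; field; rewrite gt_eqF.
have sH : H^T = H by exact: split_mx_sym.
have dH : \det H * \det H * \det (reference_mx s) = 1.
  by rewrite mulrAC -!det_mulmx HFH det1.
have sF : (reference_mx s)^T = reference_mx s by exact: split_mx_sym.
set X := H *m UU (reference_mx s) (4 * s) *m H.
have sX : X^T = X by rewrite /X !trmx_mul sH shifted_gram_sym // mulmxA.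
have X0 y : 0 <= qform X y.
  have -> : qform X y = qform (UU (reference_mx s) (4 * s)) (H *m y).
    by rewrite /qform /X dot_mulmxl sH !mulmxA.
  exact/coercive_ge0/shifted_gram_coercive/reference_coercive.
have dF0 : 0 < \det (reference_mx s) by exact: det_gt0 (heig sF) (reference_coercive s).
have dX : \det X = \det (UU (reference_mx s) (4 * s)) / \det (reference_mx s).
  have aux (h f u : R) : h * h * f = 1 -> 0 < f -> h * u * h = u / f.
    by move=> e f0; apply: (mulIf (lt0r_neq0 f0)); rewrite divfK ?gt_eqF // -[RHS]mul1r -e; ring.
  by rewrite /X !det_mulmx; apply: aux.
have HH : H *m H = split_mx theta a^-1 b^-1.
  by rewrite /H split_mxM // -!invfM -!expr2 sa sb.
have trX : \tr X = 3 + (tau s - 6 - mass s) / a + mass s / b.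
  rewrite /X mxtrace_mulC mulmxA HH /shifted_gram mulmxDr mxtraceD -addrA; congr (_ + _).
    rewrite /reference_mx -/a -/b split_mxM // !mulVf ?gt_eqF // split_mx1 mxtrace_scalar.
    by rewrite -mulr_natr mul1r.
  rewrite mulmx_sumr linear_sum /= trace_blocks // /transverse_mass.
  rewrite [6 + _]addrC addrK -sumrB !mulr_suml -big_split /=; apply: eq_bigr => c _.
  rewrite -scalemxAr linearZ /= mulmxA mxtrace_mulC.
  have -> : \tr ((blk_act c)^T *m (split_mx theta a^-1 b^-1 *m blk_act c)) =
      qform (split_mx theta a^-1 b^-1) (blk_act c).
    by rewrite /mxtrace big_ord_recl big_ord0 addr0.
  rewrite qform_split // block_action_unit // -/(blk_mean c).
  by move: (blk_w c) (blk_mean c) => w m; field; rewrite !gt_eqF.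
have m0 : 0 <= mass s.
  by apply: sumr_ge0 => c _; rewrite mulr_ge0 ?block_weight_ge0 // subr_ge0 block_mean_sqr.
(* The summands are 3, [4 * 800000] and [8 * 2000 * 40], together below 3900000. The mean eigenvalue
   is thus below [expR 16], and its cube below [expR 48]. *)
have trX_le : \tr X <= 3 * (13 * 100 * 1000).
  rewrite trX; have /andP[g1 g2] := clock_sqrt_trace s0; have g3 := clock_ge s.
  have m1 := transverse_mass_sqrt_trace heig theta1 hgood s0; rewrite -sqrt_trace_sqr //.
  move: m0 g1 g2 g3 m1 a0 b0; rewrite /a /b; move: (mass s) (hh s) (clock s) => m h g m0 g1 g2 g3 m1 a0 b0.
  have h2 : h ^+ 2 <= (2 * g) ^+ 2 by clear a0 b0; rewrite ler_sqr ?nnegrE; lra.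
  have le1 : (h ^+ 2 - 6 - m) / (g ^+ 2 / (8 * 100 * 1000)) <= 4 * (8 * 100 * 1000).
    by rewrite ler_pdivrMr //; clear a0 b0 m1; lra.
  have le2 : m / (g / 40) <= 8 * small_scale R * 40.
    by rewrite ler_pdivrMr // {a0 b0 le1 h2}; move: m1; rewrite /small_scale; lra.
  apply: le_trans (lerD (lerD (lexx _) le1) le2) _; rewrite /small_scale; lra.
have := det_le_trace (heig sX) X0; rewrite dX ler_pdivrMr // mulrC => /le_trans; apply.
rewrite ler_pM2l //.
have -> : expR 48 = expR 16 ^+ 3 :> R by rewrite -expRM_natl; congr expR; lra.
have tr0 : 0 <= \tr X.
  by rewrite (mxtrace_spectral (heig sX)); apply: sumr_ge0 => i _; rewrite eigval_qform.
rewrite lerXn2r ?nnegrE ?expR_ge0 //; first by rewrite divr_ge0.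
apply: le_trans (exp16_ge R); rewrite ler_pdivrMr //; lra.
Qed.

End History.
End Reference.

(** * Few bad samples yield a good batch *)

Section GoodStep.
Variables (R : realType) (k : nat) (eigf : 'M[R]_3 -> 'M[R]_3)
  (med : seq R -> R) (argsel : seq R -> nat) (theta0 : 'cV[R]_3).
Hypothesis heig : forall V, V^T = V -> eig_spec V (eigf V).
Hypothesis hmed : forall s : seq R, s != [::] -> is_median s (med s).
Hypothesis hargsel : forall s : seq R, s != [::] -> is_argmin s (argsel s).
Variables (theta : 'cV[R]_3) (x : nat -> bool).
Hypothesis theta1 : dot theta theta = 1.

Local Notation VV := (design_mx k eigf med argsel theta0 x).
Local Notation that := (estimate k eigf med argsel theta0 x).
Local Notation lmin := (lam_min k eigf med argsel theta0 x).
Local Notation Lam := (sqrt_lam_max k eigf med argsel theta0 x).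
Local Notation SS := (noise_sum k eigf med argsel theta0 theta x).
Local Notation UU := (shifted_gram k eigf med argsel theta0 x).
Local Notation est := (sample_estimate k eigf med argsel theta0 x).
Local Notation good := (good_batch k eigf med argsel theta0 theta x).
Local Notation qq := (small_scale R).
Local Notation Lc := (noise_level R).
Local Notation FF := (reference_mx theta).

Lemma est_residual s j : (0 < s)%N -> est s j - theta =
  invmx (VV s) *m ((- 2 *: theta + \sum_(0 <= c < 4) block_noise k eigf med argsel theta0 theta x j c)
                      + SS j (4 * s)).
Proof.
case: s => // s _; rewrite -residual_blocks mulmxBr mulKmx //; exact/coercive_unit/design_coercive.
Qed.

Lemma estimate_argmin s : (0 < s)%N -> that s = est s (argsel (scores k med (VV s) (est s))).
Proof. by case: s => // s _; rewrite estimateS. Qed.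

Lemma Vnorm_inv s z : Vnorm (VV s) (invmx (VV s) *m z) = Vnorm (invmx (VV s)) z.
Proof. by rewrite !VnormE qform_inv //; exact: design_coercive. Qed.

Lemma Vnorm_inv_le s z : Vnorm (invmx (VV s)) z <= vnorm z / Num.sqrt (lmin s).
Proof.
have cV := design_coercive k eigf med argsel theta0 x s.
have sV := design_sym k eigf med argsel theta0 x s.
have sp := design_eig k med argsel theta0 heig x s.
have l2 := lam_min_ge2 k med argsel theta0 heig x s.
have l0 : 0 < lmin s by apply: lt_le_trans l2.
have c1 : coercive (1%:M : 'M[R]_3).
  by split; [exact: trmx1|exists 1 => // y; rewrite qform_scalar].
have h : qform (invmx (VV s)) z <= (lmin s)^-1 * qform (invmx 1%:M) z.
  apply: qform_inv_le => //; first by rewrite invr_ge0 ltW.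
  move=> y; rewrite qform_scalar mul1r ler_pdivlMl //.
  exact: qform_ge_min sV sp y.
rewrite invmx1 qform_scalar mul1r in h.
rewrite VnormE vnormE; apply: le_trans (ler_wsqrtr h) _.
by rewrite sqrtrM ?invr_ge0 ?(ltW l0) // mulrC sqrtrV // ltW.
Qed.

Section Step.
Variables (s : nat).
Hypothesis s0 : (0 < s)%N.
Hypothesis hgood : forall r, (0 < r < s)%N -> good r.
Hypothesis k2 : (2 <= k)%N.
Definition bad_sample j := 256 * Lc < qform (invmx (UU (FF s) (4 * s))) (SS j (4 * s)).

Lemma qform_inv_shifted_gram z :
  qform (invmx (VV s)) z <= 6 / 5 * qform (invmx (UU (FF s) (4 * s))) z.
Proof.
apply: qform_inv_le; [exact: design_coercive| |by lra|exact: shifted_gram_le].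
exact/shifted_gram_coercive/reference_coercive.
Qed.

(** For a sample that is not bad the error has two parts: the noise, whose norm passes from the
    shifted Gram matrix to the design at the cost 6/5, and the initial bias, of length at most 10
    and divided by [sqrt lam_min >= 33]. *)
Lemma good_step : (3 * count bad_sample (iota 0 k) < k)%N -> good s.
Proof.
move=> few; rewrite /good_batch; have [//|hL] := leP (Lam s) qq; rewrite /=.
have cV := design_coercive k eigf med argsel theta0 x s.
have sV := design_sym k eigf med argsel theta0 x s.
have cU := shifted_gram_coercive k eigf med argsel theta0 x (4 * s) (reference_coercive theta1 s).
have s33 := sqrt_lmin_ge heig s0 hL.
have tri := VnormD _ _ sV (fun z => coercive_ge0 z cV).
have sVi := sym_inv sV; have Vi0 z := qform_inv_ge0 z cV.
pose rho : R := Num.sqrt (6 / 5 * (256 * Lc)) + 10 / 33.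
pose e j := Vnorm (VV s) (est s j - theta).
have few' : (3 * count (fun j => (rho < e j)%R) (iota 0 k) < k)%N.
  apply: leq_ltn_trans few; rewrite leq_mul2l /=; apply: sub_count => j /=.
  apply: contraLR; rewrite /bad_sample -!leNgt => hj; rewrite /e.
  rewrite est_residual // Vnorm_inv; apply: le_trans (VnormD _ _ sVi Vi0) _.
  rewrite addrC; apply: lerD.
    rewrite VnormE ler_wsqrtr //; apply: le_trans (qform_inv_shifted_gram _) _.
    by rewrite ler_pM2l //; lra.
  apply: le_trans (Vnorm_inv_le _ _) _; rewrite ler_pdivrMr; last by lra.
  by apply: le_trans (initial_bias _ _ _ _ _ _ _ _) _ => //; lra.
pose D j l := Vnorm (VV s) (est s j - est s l).
have Dle j l : D j l <= e j + e l.
  rewrite /D /e [Vnorm _ (est s l - _)]Vnorm_distC.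
  by apply: le_trans (tri _ _); rewrite addrA subrK.
have Dge j l : e j <= D j l + e l.
  by rewrite /D /e; apply: le_trans (tri _ _); rewrite addrA subrK.
have [_ hjs] := mom_argmin hmed hargsel Dle Dge k2 few'.
rewrite estimate_argmin //; apply: le_trans hjs _; rewrite /rho.
(* [Lc <= 4/15] makes the radicand at most 81.92, below [9.1^2 = 82.81]. *)
have : Num.sqrt (6 / 5 * (256 * Lc)) <= 91 / 10.
  have -> : 91 / 10 = Num.sqrt ((91 / 10) ^+ 2) :> R by rewrite sqrtr_sqr ger0_norm //; lra.
  rewrite ler_wsqrtr //; have := noise_level_le R; lra.
lra.
Qed.

End Step.
End GoodStep.

(** * The supermartingale *)

Section OneStep.
Variables (R : realType) (n : nat) (eigf : 'M[R]_n.+2 -> 'M[R]_n.+2).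
Hypothesis heig : forall V, V^T = V -> eig_spec V (eigf V).
Implicit Types (U : 'M[R]_n.+2) (A S : 'cV[R]_n.+2).

Lemma coercive_det_gt0 U : coercive U -> 0 < \det U.
Proof. by move=> cU; have [sU _] := cU; exact: det_gt0 (heig sU) cU. Qed.

Lemma ln1D_ge (y : R) : 0 <= y -> y / (1 + y) <= ln (1 + y).
Proof.
move=> y0; have y1 : 0 < 1 + y by lra.
have e : (1 + y)^-1 = 1 + - (y / (1 + y)) by field; rewrite gt_eqF.
have := @le_ln1Dx R (- (y / (1 + y))); rewrite -e lnV ?posrE // lerN2; apply.
by rewrite -(ltrD2l 1) -e subrr invr_gt0.
Qed.

(** With [y = w * qform (invmx U) A] the left side is [y / (1 + y)] by the rank-one inverse formula
    and the right side [ln (1 + y)] by [det_rank1]. The form is taken at the updated matrix, so no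
    bound on [y] is required. *)
Lemma elliptical_increment U A (w : R) : coercive U -> 0 <= w ->
  w * qform (invmx (U + w *: (A *m A^T))) A <=
  ln (\det (U + w *: (A *m A^T))) - ln (\det U).
Proof.
move=> cU w0; rewrite (qform_invmx_rank1 A cU w0) det_rank1 //.
have p0 := rank1_update_gt0 A cU w0; have d0 := coercive_det_gt0 cU.
rewrite lnM ?posrE // addrAC subrr add0r mulrA; apply: ln1D_ge.
by rewrite mulr_ge0 // qform_inv_ge0.
Qed.

Lemma qform_inv_rank1_le U A S (w : R) : coercive U -> 0 <= w ->
  qform (invmx (U + w *: (A *m A^T))) S <= qform (invmx U) S.
Proof.
move=> cU w0; rewrite -[leRHS]mul1r; apply: qform_inv_le => //.
  exact: coercive_rank1.
by move=> y; rewrite mul1r qformDl qformZl qform_rank1 lerDl mulr_ge0 // sqr_ge0.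
Qed.

Definition energy (K N : R) U S := (1 + qform (invmx U) S / K) * expR (- ln (\det U) / N).

Lemma energy_ge0 K N U S : 0 < K -> coercive U -> 0 <= energy K N U S.
Proof.
move=> K0 cU; rewrite mulr_ge0 ?expR_ge0 // addr_ge0 // divr_ge0 ?(ltW K0) //.
exact: qform_inv_ge0.
Qed.

(* Averaged over the reward, the quadratic form grows by at most
   [L * (ln (det U') - ln (det U))], which the factor [expR (- ln (det U) / N)] pays for. *)
Lemma energy_step (L N w m : R) U A S : coercive U -> 0 <= w -> 0 < L -> 0 < N ->
  -1 <= m <= 1 -> w * (1 - m ^+ 2) <= L ->
  forall U', U' = U + w *: (A *m A^T) ->
  (1 + m) / 2 * energy (L * N) N U' (S + (w * (1 - m)) *: A) +
  (1 - (1 + m) / 2) * energy (L * N) N U' (S + (w * (- 1 - m)) *: A) <= energy (L * N) N U S.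
Proof.
move=> cU w0 L0 N0 m1 wm U' eU'; rewrite /energy.
have cU' : coercive U' by rewrite eU'; exact: coercive_rank1.
have [sU' _] := cU'.
have exp c : qform (invmx U') (S + c *: A) =
    qform (invmx U') S + 2 * c * dot S (invmx U' *m A) + c ^+ 2 * qform (invmx U') A.
  rewrite /qform mulmxDr -scalemxAr !dot_lin.
  have -> : dot A (invmx U' *m S) = dot S (invmx U' *m A).
    by rewrite dotC dot_mulmxl sym_inv.
  ring.
rewrite !exp.
have h1 : qform (invmx U') S <= qform (invmx U) S by rewrite eU'; exact: qform_inv_rank1_le.
have h2 := elliptical_increment A cU w0; rewrite -eU' in h2.
have h3 : 0 <= qform (invmx U') A by exact: qform_inv_ge0.
have h4 : 0 <= qform (invmx U') S by exact: qform_inv_ge0.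
move: (qform (invmx U') S) (qform (invmx U) S) (qform (invmx U') A) (dot S _) h1 h2 h3 h4
  => z' z a d h1 h2 h3 h4.
have -> : - ln (\det U) / N = - ln (\det U') / N + (ln (\det U') - ln (\det U)) / N.
  by field; rewrite gt_eqF.
rewrite expRD; move: (expR _) (expR_ge0 (- ln (\det U') / N)) => E E0.
move: (ln _ - ln _) h2 => l h2.
have l0 : 0 <= l by apply: le_trans h2; rewrite mulr_ge0.
have NN : 0 < L * N by rewrite mulr_gt0.
apply: (@le_trans _ _ (E * (1 + z / (L * N)) * (1 + l / N))); last first.
  rewrite -!mulrA [leRHS]mulrCA ler_wpM2l // ler_wpM2l ?expR_ge1Dx //.
  by rewrite addr_ge0 // divr_ge0 ?(ltW NN) // (le_trans h4).
(* The average over the reward: the linear term vanishes because the noise is centred, and a reward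
   of values 1 and -1 with mean [m] has variance [1 - m^2]. *)
have -> : (1 + m) / 2 *
  ((1 + (z' + 2 * (w * (1 - m)) * d + (w * (1 - m)) ^+ 2 * a) / (L * N)) * E) +
  (1 - (1 + m) / 2) *
  ((1 + (z' + 2 * (w * (-1 - m)) * d + (w * (-1 - m)) ^+ 2 * a) / (L * N)) * E) =
  E * (1 + (z' + w * (1 - m ^+ 2) * (w * a)) / (L * N)).
  by field; rewrite !gt_eqF.
rewrite -[leRHS]mulrA ler_wpM2l //.
have wa0 : 0 <= w * a by rewrite mulr_ge0.
have h5 : z' + w * (1 - m ^+ 2) * (w * a) <= z + L * l.
  apply: lerD => //; apply: (@le_trans _ _ (L * (w * a))); first by rewrite ler_wpM2r.
  by rewrite ler_pM2l.
apply: (@le_trans _ _ (1 + (z + L * l) / (L * N))).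
  by rewrite lerD2l ler_pM2r ?invr_gt0.
have -> : (1 + z / (L * N)) * (1 + l / N) = 1 + (z + L * l) / (L * N) + z / (L * N) * (l / N).
  by field; rewrite !gt_eqF.
rewrite lerDl mulr_ge0 // divr_ge0 ?(ltW NN) ?(ltW N0) //; exact: le_trans h1.
Qed.

(** Covers the blocks of the first batch, which enlarge the Gram matrix while their noise is not
    counted. *)
Lemma energy_idle (K N w : R) U A : coercive U -> 0 <= w -> 0 < N ->
  energy K N (U + w *: (A *m A^T)) 0 <= energy K N U 0.
Proof.
move=> cU w0 N0; rewrite /energy /qform !dot0l mul0r addr0 !mul1r ler_expR.
rewrite ler_pM2r ?invr_gt0 // lerN2.
rewrite -subr_ge0.
have cU' := coercive_rank1 A cU w0.
apply: le_trans (elliptical_increment A cU w0); rewrite mulr_ge0 //; exact: qform_inv_ge0.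
Qed.

End OneStep.

(** * Dependence on past rewards only *)

Section Extensionality.
Variables (R : realType) (k : nat) (eigf : 'M[R]_3 -> 'M[R]_3)
  (med : seq R -> R) (argsel : seq R -> nat) (theta0 theta : 'cV[R]_3).
Hypothesis hargsel : forall s : seq R, s != [::] -> is_argmin s (argsel s).
Hypothesis k0 : (0 < k)%N.

Local Notation VV := (design_mx k eigf med argsel theta0).
Local Notation that := (estimate k eigf med argsel theta0).
Local Notation bb := (moment_vec k eigf med argsel theta0).
Local Notation wt := (batch_weight k eigf med argsel theta0).
Local Notation blk_act := (block_action k eigf med argsel theta0).
Local Notation blk_w := (block_weight k eigf med argsel theta0).
Local Notation noise := (block_noise k eigf med argsel theta0 theta).
Local Notation SS := (noise_sum k eigf med argsel theta0 theta).
Local Notation UU := (shifted_gram k eigf med argsel theta0).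
Local Notation est := (sample_estimate k eigf med argsel theta0).
Local Notation good := (good_batch k eigf med argsel theta0 theta).

Definition agree m (x x' : nat -> bool) := forall r, (r < m)%N -> x r = x' r.

Lemma agree_le m p x x' : (p <= m)%N -> agree m x x' -> agree p x x'.
Proof. by move=> pm h r rp; apply: h; apply: leq_trans pm. Qed.

Lemma round_of_lt s (i : 'I_2) sg j : (j < k)%N -> (round_of (n := 1) k s.+1 i sg j < 4 * k * s.+1)%N.
Proof.
move=> jk; rewrite /round_of /batch_len /=.
have h : ((2 * i + (if sg then 0 else 1)) * k <= 3 * k)%N.
  by rewrite leq_mul2r; apply/orP; right; have := ltn_ord i; case: sg; lia.
move: h; move: ((2 * i + _) * k)%N => a h; nia.
Qed.

Lemma scores_ext V (e e' : nat -> 'cV[R]_3) : (forall j, (j < k)%N -> e j = e' j) ->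
  scores k med V e = scores k med V e'.
Proof.
move=> h; apply/eq_in_map => j; rewrite mem_iota => /= jk; congr med.
apply/eq_in_map => l; rewrite mem_filter mem_iota => /andP[_ /= lk].
by rewrite !h.
Qed.

Lemma scores_argsel V (e : nat -> 'cV[R]_3) : (argsel (scores k med V e) < k)%N.
Proof.
have L0 : scores k med V e != [::] by rewrite -size_eq0 size_map size_iota -lt0n.
by have [+ _] := hargsel L0; rewrite size_map size_iota.
Qed.

(** The moments are compared for [j < k] only, since a larger [j] may read later rounds. The
    estimate is not affected: [argsel] returns an index below [k]. *)
Lemma state_ext x x' s : agree (4 * k * s) x x' ->
  [/\ VV x s = VV x' s, that x s = that x' s & forall j, (j < k)%N -> bb x s j = bb x' s j].
Proof.
elim: s => [|s IH] ag; first by split.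
have ag' : agree (4 * k * s) x x' by apply: agree_le ag; rewrite leq_mul2l leqnSn orbT.
have [eV eth eb] := IH ag'.
have ew : wt x s = wt x' s by rewrite /batch_weight eV.
have eV' : VV x s.+1 = VV x' s.+1 by rewrite !design_mxS ew eV eth.
have eb' j : (j < k)%N -> bb x s.+1 j = bb x' s.+1 j.
  move=> jk; rewrite 2!moment_vecS (eb j jk) ew eV eth; congr (_ + _); congr (_ *: _).
  apply: eq_bigr => i _.
  by rewrite (ag _ (round_of_lt s i true jk)) (ag _ (round_of_lt s i false jk)).
have ee j : (j < k)%N -> est x s.+1 j = est x' s.+1 j.
  by move=> jk; rewrite /sample_estimate eV' eb'.
split=> //; rewrite 2!estimateS eV' (scores_ext _ ee).
apply: ee; exact: scores_argsel.
Qed.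

Lemma block_ext x x' b : agree (k * b) x x' ->
  blk_act x b = blk_act x' b /\ blk_w x b = blk_w x' b.
Proof.
move=> ag; have ag' : agree (4 * k * (b %/ 4)) x x'.
  by apply: agree_le ag; rewrite mulnAC mulnC leq_mul2l; apply/orP; right; rewrite mulnC leq_divM.
have [eV eth _] := state_ext ag'.
by rewrite /block_action /block_weight /batch_weight eV eth.
Qed.

Lemma block_noise_ext x x' j b : agree (k * b) x x' -> x (b * k + j)%N = x' (b * k + j)%N ->
  noise x j b = noise x' j b.
Proof.
move=> /block_ext[ea ew] ex.
by rewrite /block_noise /block_mean /block_reward ea ew ex.
Qed.

Lemma noise_sum_ext x x' j b : (j < k)%N -> agree (k * b) x x' -> SS x j b = SS x' j b.
Proof.
move=> jk ag; rewrite /noise_sum; apply: eq_big_nat => c /andP[_ cb].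
have kc : (k * c.+1 <= k * b)%N by rewrite leq_mul2l cb orbT.
apply: block_noise_ext; first by apply: agree_le ag; rewrite leq_mul2l ltnW ?orbT.
by apply: ag; apply: leq_trans kc; rewrite mulnS addnC [(k * c)%N]mulnC ltn_add2r.
Qed.

Lemma shifted_gram_ext x x' F b : agree (k * b) x x' -> UU x F b = UU x' F b.
Proof.
move=> ag; rewrite /shifted_gram; congr (_ + _); apply: eq_big_nat => c /andP[_ cb].
have /block_ext[-> ->] // : agree (k * c) x x'.
by apply: agree_le ag; rewrite leq_mul2l ltnW ?orbT.
Qed.

(** The action of a block is fixed before its first reward, so the Gram matrix is known one block
    ahead. This lets the samples be updated one by one within a block. *)
Lemma shifted_gram_extS x x' F b : agree (k * b) x x' -> UU x F b.+1 = UU x' F b.+1.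
Proof. by move=> ag; rewrite !shifted_gramS (shifted_gram_ext _ ag); have [-> ->] := block_ext ag. Qed.

Lemma noise_sumS x j b : SS x j b.+1 = SS x j b + (if (4 <= b)%N then noise x j b else 0).
Proof.
rewrite /noise_sum; case: (leqP 4 b) => h; first by rewrite big_nat_recr.
by rewrite !big_geq ?addr0 // ltnW.
Qed.

Lemma noise_sum_extS x x' j b : (j < k)%N -> agree (k * b) x x' ->
  x (b * k + j)%N = x' (b * k + j)%N -> SS x j b.+1 = SS x' j b.+1.
Proof.
by move=> jk ag ex; rewrite 2!noise_sumS (noise_sum_ext jk ag) (block_noise_ext ag ex).
Qed.

Lemma good_ext x x' r : agree (4 * k * r) x x' -> good x r = good x' r.
Proof. by move=> /state_ext[eV eth _]; rewrite /good_batch /sqrt_lam_max /lam_max eV eth. Qed.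

End Extensionality.

Lemma prod_ordD1 (R : comPzRingType) k (f : nat -> R) i : (i < k)%N ->
  \prod_(j < k) f j = f i * \prod_(j < k | j != i :> nat) f j.
Proof. by move=> ik; rewrite (bigD1 (Ordinal ik)). Qed.

(** Round [t] advances the factor [t %% k] alone. At the end of a block the quotient steps up and
    the Boolean offsets reset, which gives the same indices; [f] belongs to the new path and [g] to
    the old one. *)
Lemma prod_round (R : comPzRingType) (f g : nat -> nat -> R) k t : (0 < k)%N ->
  (forall j, (j < k)%N -> (j < t %% k)%N -> f j (t %/ k)%N.+1 = g j (t %/ k)%N.+1) ->
  (forall j, (j < k)%N -> (t %% k < j)%N -> f j (t %/ k)%N = g j (t %/ k)%N) ->
  \prod_(j < k) f j (t.+1 %/ k + (j < t.+1 %% k))%N =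
  f (t %% k)%N (t %/ k)%N.+1 * \prod_(j < k | j != (t %% k)%N :> nat) g j (t %/ k + (j < t %% k))%N.
Proof.
move=> k0; set b := (t %/ k)%N; set j0 := (t %% k)%N => flt fgt.
have jk : (j0 < k)%N by rewrite ltn_mod.
have et : t = (b * k + j0)%N by exact: divn_eq.
rewrite (prod_ordD1 (fun j => f j (t.+1 %/ k + (j < t.+1 %% k))%N) jk).
have idx j : (j < k)%N -> (t.+1 %/ k + (j < t.+1 %% k) = b + (j <= j0))%N.
  move=> jk'; rewrite et -addnS; case: (ltngtP j0.+1 k) jk => // [h _|e _].
    by rewrite divnMDl // modnMDl divn_small // modn_small // addn0 ltnS.
  rewrite e divnMDl // modnMDl divnn modnn k0 ltn0 addn0; congr (_ + _)%N.
  by have -> : (j <= j0)%N by lia.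
rewrite idx // leqnn addn1; congr (_ * _); apply: eq_bigr => j hj.
rewrite idx //; case: (ltngtP j j0) hj => // [h _|h _].
  by rewrite addn1 flt.
by rewrite addn0 fgt.
Qed.

(** * The potential of a tested batch *)

Section Potential.
Variables (R : realType) (k : nat) (eigf : 'M[R]_3 -> 'M[R]_3)
  (med : seq R -> R) (argsel : seq R -> nat) (theta0 theta : 'cV[R]_3).
Hypothesis heig : forall V, V^T = V -> eig_spec V (eigf V).
Hypothesis hargsel : forall s : seq R, s != [::] -> is_argmin s (argsel s).
Hypothesis theta1 : dot theta theta = 1.
Hypothesis k0 : (0 < k)%N.
Variable s : nat.

Local Notation blk_act := (block_action k eigf med argsel theta0).
Local Notation blk_w := (block_weight k eigf med argsel theta0).
Local Notation blk_mean := (block_mean k eigf med argsel theta0 theta).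
Local Notation SS := (noise_sum k eigf med argsel theta0 theta).
Local Notation UU := (shifted_gram k eigf med argsel theta0).
Local Notation good := (good_batch k eigf med argsel theta0 theta).
Local Notation bad_sample := (bad_sample k eigf med argsel theta0 theta).
Local Notation F := (reference_mx theta s).
Local Notation Lc := (noise_level R).

(* Since [384 = 8 * 48], the determinant factor loses at most [expR (1 / 8)] per sample, while
   a bad sample gains [1 + 256 / 384 = 5 / 3 >= expR (1 / 2)]. *)
Definition sample_energy x j b := energy (Lc * 384) 384 (UU x F b) (SS x j b).

(** The current batch [b %/ 4] is included, since its estimate determines the actions of block [b];
    batch [s], the one under test, is excluded. *)
Definition past_good x b : bool := [forall r : 'I_s, (0 < r <= b %/ 4)%N ==> good x r].

(* At round [t] the samples [j < t %% k] have already received their reward in this block. *)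
Definition potential x t : R :=
  (past_good x (t %/ k)%N)%:R * \prod_(j < k) sample_energy x j ((t %/ k) + (j < t %% k)%N).

Lemma potential_gram_coercive x b : coercive (UU x F b).
Proof. exact/shifted_gram_coercive/reference_coercive. Qed.

Lemma sample_energy_ge0 x j b : 0 <= sample_energy x j b.
Proof.
apply: energy_ge0; last exact: potential_gram_coercive.
apply: mulr_gt0; [exact: noise_level_gt0|lra].
Qed.

Lemma past_good_le x b c : (b <= c)%N -> past_good x c -> past_good x b.
Proof.
move=> bc /forallP h; apply/forallP => r; apply/implyP => /andP[r0 rb].
by apply: (implyP (h r)); rewrite r0 (leq_trans rb) // leq_div2r.
Qed.

Lemma past_good_ext x x' b : agree (k * b) x x' -> past_good x b = past_good x' b.
Proof.
move=> ag; apply: eq_forallb => r; have [/andP[_ rb]|//] := boolP (0 < r <= b %/ 4)%N; rewrite !implyTb.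
apply: (good_ext eigf med theta0 theta hargsel k0); apply: agree_le ag.
rewrite -mulnA mulnCA leq_mul2l; apply/orP; right.
by apply: leq_trans (leq_mul (leqnn 4) rb) _; rewrite mulnC leq_divM.
Qed.

Lemma sample_energy_step x x1 x0 b j : (j < k)%N -> (b < 4 * s)%N -> past_good x b ->
  agree (b * k + j) x x1 -> agree (b * k + j) x x0 ->
  x1 (b * k + j)%N = true -> x0 (b * k + j)%N = false ->
  (1 + blk_mean x b) / 2 * sample_energy x1 j b.+1 +
  (1 - (1 + blk_mean x b) / 2) * sample_energy x0 j b.+1 <= sample_energy x j b.
Proof.
move=> jk bs hg ag1 ag0 e1 e0.
have sub : (k * b <= b * k + j)%N by rewrite mulnC leq_addr.
have {}ag1 := agree_le sub ag1; have {}ag0 := agree_le sub ag0.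
have L0 := noise_level_gt0 R; have N0 : 0 < 384 :> R by lra.
have cU := potential_gram_coercive x b; have w0 := block_weight_ge0 k eigf med argsel theta0 x b.
have eU x' : agree (k * b) x x' ->
    UU x' F b.+1 = UU x F b + blk_w x b *: (blk_act x b *m (blk_act x b)^T).
  by move=> ag; rewrite -shifted_gramS (shifted_gram_extS eigf med theta0 hargsel k0 _ ag).
have eS x' : agree (k * b) x x' -> SS x' j b.+1 = SS x j b +
    (if (4 <= b)%N then (blk_w x b * ((2 * (x' (b * k + j)%N)%:R - 1) - blk_mean x b)) *: blk_act x b else 0).
  move=> ag; have [ea ew] := block_ext eigf med theta0 hargsel k0 ag.
  by rewrite noise_sumS (noise_sum_ext eigf med theta0 theta hargsel k0 jk ag) /block_noise /block_mean ea ew.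
rewrite /sample_energy !eU // !eS // e1 e0 mulr0 mulr1 sub0r.
have -> : 2 - 1 = 1 :> R by lra.
have [b4|b4] := leqP 4 b.
  have hm := block_mean_bounds k med argsel theta0 heig x theta1 b.
  have hv : blk_w x b * (1 - blk_mean x b ^+ 2) <= Lc.
    apply: good_variance; [exact: heig|exact: theta1|by rewrite divn_gt0|].
    have rs : (b %/ 4 < s)%N by rewrite ltn_divLR // mulnC.
    by move/forallP: hg => /(_ (Ordinal rs))/implyP; apply; rewrite /= divn_gt0 // b4 leqnn.
  exact: (@energy_step R 1 eigf heig Lc 384 (blk_w x b) (blk_mean x b) _ (blk_act x b)
    (SS x j b) cU w0 L0 N0 hm hv _ erefl).
have S0 : SS x j b = 0 by rewrite /noise_sum big_geq // ltnW.
rewrite S0 addr0 -mulrDl [_ + (1 - _)]addrC subrK mul1r.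
exact: (@energy_idle R 1 eigf heig _ 384 _ _ (blk_act x b) cU w0 N0).
Qed.

(** Only an inequality: round [t + 1] may open a batch whose estimate is bad, and the indicator then
    drops to zero. *)
Lemma potential_update x x' t : agree t x x' ->
  potential x' t.+1 <= (past_good x (t %/ k)%N)%:R *
   (sample_energy x' (t %% k)%N (t %/ k)%N.+1 *
    \prod_(j < k | j != (t %% k)%N :> nat) sample_energy x j ((t %/ k) + (j < t %% k)%N)).
Proof.
move=> ag; set b := (t %/ k)%N.
have et : t = (b * k + t %% k)%N by exact: divn_eq.
have sub : (k * b <= t)%N by rewrite et mulnC leq_addr.
have agb := agree_le sub ag.
have hlt j : (j < k)%N -> (j < t %% k)%N -> sample_energy x' j b.+1 = sample_energy x j b.+1.
  move=> jk jt; have ex : x (b * k + j)%N = x' (b * k + j)%N.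
    by apply: ag; rewrite [X in (_ < X)%N]et ltn_add2l.
  rewrite /sample_energy (shifted_gram_extS eigf med theta0 hargsel k0 _ agb).
  by rewrite (noise_sum_extS eigf med theta0 theta hargsel k0 jk agb ex).
have hgt j : (j < k)%N -> (t %% k < j)%N -> sample_energy x' j b = sample_energy x j b.
  move=> jk _; rewrite /sample_energy (shifted_gram_ext eigf med theta0 hargsel k0 _ agb).
  by rewrite (noise_sum_ext eigf med theta0 theta hargsel k0 jk agb).
have f0 := sample_energy_ge0 x'; have g0 := sample_energy_ge0 x.
have hp : ((past_good x' (t.+1 %/ k)%N)%:R <= (past_good x b)%:R :> R).
  have eg := past_good_ext agb.
  rewrite ler_nat eg; have := @past_good_le x' b (t.+1 %/ k)%N (leq_div2r k (leqnSn t)).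
  by case: (past_good x' _) => // ->.
rewrite /potential; move: (sample_energy x') (sample_energy x) hlt hgt f0 g0 => f g hlt hgt f0 g0.
rewrite (prod_round k0 hlt hgt); apply: ler_wpM2r => //.
by rewrite mulr_ge0 // prodr_ge0.
Qed.

Lemma potential_step x x1 x0 t : (t < 4 * k * s)%N -> agree t x x1 -> agree t x x0 ->
  x1 t = true -> x0 t = false ->
  (1 + blk_mean x (t %/ k)%N) / 2 * potential x1 t.+1 +
  (1 - (1 + blk_mean x (t %/ k)%N) / 2) * potential x0 t.+1 <= potential x t.
Proof.
move=> ts ag1 ag0 e1 e0.
set b := (t %/ k)%N; set m := blk_mean x b.
have et : t = (b * k + t %% k)%N by exact: divn_eq.
have jk : (t %% k < k)%N by rewrite ltn_mod.
have bs : (b < 4 * s)%N by rewrite ltn_divLR // mulnAC.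
have /andP[m1 m2] : -1 <= m <= 1 by exact: block_mean_bounds.
have hst : past_good x b -> (1 + m) / 2 * sample_energy x1 (t %% k) b.+1 +
    (1 - (1 + m) / 2) * sample_energy x0 (t %% k) b.+1 <= sample_energy x (t %% k) b.
  move=> hg; rewrite et in ag1 ag0 e1 e0.
  exact: (sample_energy_step jk bs hg ag1 ag0 e1 e0).
have u1 := potential_update ag1; have u0 := potential_update ag0.
have f0 := sample_energy_ge0 x.
rewrite [potential x t]/potential -/b.
move: hst u1 u0; rewrite -/b.
move: (potential x1 _) (potential x0 _) (sample_energy x1 _ _) (sample_energy x0 _ _) (sample_energy x) f0 (past_good x b)
  => p1 p0 E1 E0 f f0 [] hst u1 u0; last by move: u1 u0; rewrite !mul0r; nra.
rewrite mul1r (prod_ordD1 (fun j => f j (b + (j < t %% k))%N) jk) ltnn addn0.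
move: u1 u0; rewrite !mul1r; set P := \prod_(_ < _ | _) _ => u1 u0.
have P0 : 0 <= P by exact: prodr_ge0.
apply: (@le_trans _ _ (((1 + m) / 2 * E1 + (1 - (1 + m) / 2) * E0) * P)).
  by rewrite [leRHS]mulrDl -[X in _ <= X + _]mulrA -[X in _ <= _ + X]mulrA; apply: lerD; apply: ler_wpM2l => //; lra.
by rewrite ler_wpM2r // hst.
Qed.

Lemma potential0 x : potential x 0 = expR (- ln (\det F) / 384) ^+ k.
Proof.
rewrite /potential div0n mod0n.
have -> : past_good x 0.
  by apply/forallP => r; apply/implyP; rewrite div0n leqn0 => /andP[r0 /eqP e]; rewrite e in r0.
rewrite mul1r (eq_bigr (fun=> expR (- ln (\det F) / 384))) => [|j _].
  by rewrite prodr_const card_ord.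
rewrite ltn0 addn0 /sample_energy /energy /shifted_gram /noise_sum !big_geq // addr0.
by rewrite /qform dot0l mul0r addr0 mul1r.
Qed.

Lemma potential_final x : (0 < s)%N -> past_good x (4 * s) ->
  (k <= 3 * count (bad_sample x s) (iota 0 k))%N ->
  expR (k%:R / 24) * potential x 0 <= potential x (4 * k * s).
Proof.
move=> s0 hg hbad; rewrite potential0 /potential.
have -> : (4 * k * s = (4 * s) * k)%N by rewrite mulnAC.
rewrite mulnK // modnMl hg mul1r.
have hgood r : (0 < r < s)%N -> good x r.
  move=> /andP[r0 rs]; move/forallP: hg => /(_ (Ordinal rs))/implyP; apply.
  by rewrite /= r0 mulKn // ltnW.
have L0 := noise_level_gt0 R.
set E := expR (- ln (\det F) / 384).
have hj j : expR ((bad_sample x s j)%:R / 2 - 1 / 8) * E <= sample_energy x j (4 * s).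
  rewrite /sample_energy /energy expRD -mulrA; apply: ler_pM; rewrite ?expR_ge0 //.
  - by rewrite mulr_ge0 // expR_ge0.
  - have Z0 := qform_inv_ge0 (SS x j (4 * s)) (potential_gram_coercive x (4 * s)).
    rewrite /bad_sample; move: (qform _ _) Z0 => Z Z0.
    have K0 : 0 < Lc * 384 by apply: (mulr_gt0 L0); lra.
    case: ltP => [h|_].
      apply: le_trans (exp_half_le R) _.
      have -> : 5 / 3 = 1 + 256 * Lc / (Lc * 384) :> R by field; rewrite gt_eqF.
      by rewrite lerD2l ler_pM2r ?invr_gt0 // ltW.
    by rewrite mul0r expR0 lerDl; exact: divr_ge0 Z0 (ltW K0).
  - rewrite -expRD ler_expR.
    have dF := coercive_det_gt0 heig (reference_coercive theta1 s).
    have dU := coercive_det_gt0 heig (potential_gram_coercive x (4 * s)).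
    have := det_shifted_gram_le heig theta1 s0 hgood.
    rewrite -(ler_ln (R := R)) ?posrE ?mulr_gt0 ?expR_gt0 // lnM ?posrE ?expR_gt0 // expRK.
    lra.
under eq_bigr do rewrite ltn0 addn0.
apply: (@le_trans _ _ (\prod_(j < k) (expR ((bad_sample x s j)%:R / 2 - 1 / 8) * E))); last first.
  by apply: ler_prod => j _; rewrite hj mulr_ge0 ?expR_ge0.
rewrite big_split /= prodr_const card_ord ler_wpM2r ?exprn_ge0 ?expR_ge0 //.
rewrite -expR_sum ler_expR sumrB sumr_const card_ord -mulr_suml -mulr_natr.
have -> : \sum_(j < k) (bad_sample x s j)%:R = (count (bad_sample x s) (iota 0 k))%:R :> R.
  have -> : iota 0 k = index_iota 0 k by rewrite /index_iota subn0.
  rewrite -sum1_count natr_sum [RHS]big_mkcond big_mkord /=.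
  by apply: eq_bigr => j _; case: bad_sample.
have : k%:R <= 3 * (count (bad_sample x s) (iota 0 k))%:R :> R.
  by rewrite -natrM ler_nat.
lra.
Qed.

End Potential.

(** * Law of the bandit process *)

Section Expectation.
Variables (R : realType) (psi : 'cV[R[i]]_2) (pol : policy R).

Definition ffun_rcons T (x : {ffun 'I_T -> bool}) (b : bool) : {ffun 'I_T.+1 -> bool} :=
  [ffun i : 'I_T.+1 => if insub (i : nat) is Some j then x j else b].

Lemma codom_ffun_rcons T (x : {ffun 'I_T -> bool}) b :
  codom (ffun_rcons x b) = rcons (codom x) b.
Proof.
rewrite !codomE enum_ordSr map_rcons -map_comp; congr rcons.
  apply: eq_map => i /=; rewrite ffunE; case: insubP => [j _ /val_inj <- //|/=].
  by rewrite ltn_ord.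
by rewrite ffunE; case: insubP => //= j; rewrite ltnn.
Qed.

Lemma sum_ffun_rcons T (F : seq bool -> R) :
  \sum_(x : {ffun 'I_T.+1 -> bool}) F (codom x) =
  \sum_(x : {ffun 'I_T -> bool}) (F (rcons (codom x) true) + F (rcons (codom x) false)).
Proof.
pose h (p : {ffun 'I_T -> bool} * bool) := ffun_rcons p.1 p.2.
pose g (f : {ffun 'I_T.+1 -> bool}) :=
  ([ffun i : 'I_T => f (widen_ord (leqnSn T) i)], f ord_max).
rewrite (reindex h) /=; last first.
  exists g => [[x b]|f] _; rewrite /g /h /=.
    congr pair; last by rewrite ffunE; case: insubP => //= j; rewrite ltnn.
    apply/ffunP => i; rewrite !ffunE; case: insubP => [j _ /val_inj <- //|/=].
    by rewrite ltn_ord.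
  apply/ffunP => i; rewrite !ffunE; case: insubP => [j _ e|/=].
    by rewrite ffunE; congr (f _); apply: val_inj.
  by rewrite -leqNgt => h1; congr (f _); apply: val_inj; apply/eqP; rewrite eqn_leq h1 -ltnS ltn_ord.
rewrite -(pair_big predT predT (fun x b => F (codom (h (x, b))))) /=.
apply: eq_bigr => x _; rewrite big_bool /= /h /=.
by rewrite !codom_ffun_rcons.
Qed.

(** The same law on lists, where the horizon can grow by appending one reward. *)
Definition path_prob T (h : seq bool) : R :=
  \prod_(t < T) (let p := born psi (pol t (take t h)) in if nth false h t then p else 1 - p).

Lemma nth_codom T (x : {ffun 'I_T -> bool}) (t : 'I_T) : nth false (codom x) t = x t.
Proof. by rewrite codomE (nth_map t) ?size_enum_ord // nth_ord_enum. Qed.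

Lemma seq_prob_path T (x : {ffun 'I_T -> bool}) : seq_prob psi pol x = path_prob T (codom x).
Proof. by apply: eq_bigr => t _; rewrite nth_codom. Qed.

Lemma size_codom_ord T (x : {ffun 'I_T -> bool}) : size (codom x) = T.
Proof. by rewrite size_codom card_ord. Qed.

Lemma path_prob_rcons T h b : size h = T ->
  path_prob T.+1 (rcons h b) =
  path_prob T h * (let p := born psi (pol T h) in if b then p else 1 - p).
Proof.
move=> sh; pose F g t := let p := born psi (pol t (take t g)) in if nth false g t then p else 1 - p.
have e1 : \prod_(t < T) F (rcons h b) t = path_prob T h.
  apply: eq_bigr => t _; have tT := ltn_ord t.
  by rewrite /F nth_rcons sh tT -cats1 takel_cat // sh ltnW.
have e2 : F (rcons h b) T = let p := born psi (pol T h) in if b then p else 1 - p.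
  by rewrite /F nth_rcons sh ltnn eqxx -sh -cats1 take_size_cat.
by rewrite -e1 -e2; exact: big_ord_recr.
Qed.

Lemma Expect_rcons T (f : seq bool -> R) :
  Expect psi pol (fun x : {ffun 'I_T.+1 -> bool} => f (codom x)) =
  Expect psi pol (fun x : {ffun 'I_T -> bool} =>
    let p := born psi (pol T (codom x)) in
    p * f (rcons (codom x) true) + (1 - p) * f (rcons (codom x) false)).
Proof.
rewrite /Expect; under eq_bigr do rewrite seq_prob_path.
rewrite (sum_ffun_rcons T (fun h => path_prob T.+1 h * f h)); apply: eq_bigr => x _.
rewrite !path_prob_rcons ?size_codom_ord // seq_prob_path.
by rewrite /=; move: (path_prob _ _) (born _ _) (f _) (f _) => a b c d; ring.
Qed.

Lemma Expect_nil (f : seq bool -> R) :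
  Expect psi pol (fun x : {ffun 'I_0 -> bool} => f (codom x)) = f [::].
Proof.
rewrite /Expect (eq_bigr (fun=> f [::])) => [|x _]; last first.
  rewrite seq_prob_path /path_prob big_ord0 mul1r; congr f.
  by apply: size0nil; rewrite size_codom_ord.
by rewrite sumr_const card_ffun card_bool card_ord.
Qed.

Lemma ExpectZ T (c : R) (f : {ffun 'I_T -> bool} -> R) :
  Expect psi pol (fun x => c * f x) = c * Expect psi pol f.
Proof. by rewrite /Expect mulr_sumr; apply: eq_bigr => x _; rewrite mulrCA. Qed.

Lemma ExpectD T (f g : {ffun 'I_T -> bool} -> R) :
  Expect psi pol (fun x => f x + g x) = Expect psi pol f + Expect psi pol g.
Proof. by rewrite /Expect -big_split; apply: eq_bigr => x _; rewrite mulrDr. Qed.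

Lemma Expect_sum T (I : Type) (r : seq I) (F : I -> {ffun 'I_T -> bool} -> R) :
  Expect psi pol (fun x => \sum_(i <- r) F i x) = \sum_(i <- r) Expect psi pol (F i).
Proof.
by rewrite /Expect exchange_big /=; apply: eq_bigr => x _; rewrite mulr_sumr.
Qed.

Hypothesis valid : forall t h, 0 <= born psi (pol t h) <= 1.

Lemma seq_prob_ge0 T (x : {ffun 'I_T -> bool}) : 0 <= seq_prob psi pol x.
Proof.
apply: prodr_ge0 => t _ /=; have /andP[p0 p1] := valid t (hist x t).
by case: (x t); rewrite ?subr_ge0.
Qed.

Lemma Expect_le T (f g : {ffun 'I_T -> bool} -> R) : (forall x, f x <= g x) ->
  Expect psi pol f <= Expect psi pol g.
Proof.
by move=> h; apply: ler_sum => x _; rewrite ler_wpM2l ?seq_prob_ge0.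
Qed.

(** Truncating the history freezes the process at time [t0], so the one-step inequality is needed
    before [t0] only; the remaining rounds integrate to one. *)
Lemma Expect_supermartingale T t0 (f : seq bool -> R) :
  (forall h, (size h < t0)%N -> let p := born psi (pol (size h) h) in
     p * f (rcons h true) + (1 - p) * f (rcons h false) <= f h) ->
  Expect psi pol (fun x : {ffun 'I_T -> bool} => f (take t0 (codom x))) <= f [::].
Proof.
move=> step; elim: T => [|T IH].
  by rewrite (Expect_nil (fun h => f (take t0 h))).
rewrite (Expect_rcons T (fun h => f (take t0 h))); apply: le_trans IH.
apply: Expect_le => x /=; have sx := size_codom_ord x.
case: (ltnP T t0) => h.
  rewrite !take_oversize ?size_rcons ?sx //; last exact: ltnW.
  by have := step (codom x); rewrite sx => /(_ h).
by rewrite -!cats1 !takel_cat ?sx // -mulrDl addrC subrK mul1r.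
Qed.

Lemma Expect_cst T (c : R) : Expect psi pol (fun _ : {ffun 'I_T -> bool} => c) = c.
Proof.
elim: T => [|T IH]; first by rewrite (Expect_nil (fun=> c)).
rewrite (Expect_rcons T (fun=> c)) -[RHS]IH; congr Expect.
by apply: funext => x /=; rewrite -mulrDl addrC subrK mul1r.
Qed.

End Expectation.

(** * Bloch vectors *)

Section Bloch.
Variable R : realType.
Implicit Types (psi : 'cV[R[i]]_2) (a : 'cV[R]_3).

Lemma dot3 (u v : 'cV[R]_3) : dot u v = bx u * bx v + by_ u * by_ v + bz u * bz v.
Proof.
rewrite dotE !big_ord_recl big_ord0 addr0 addrA /bx /by_ /bz.
have -> : lift ord0 ord0 = inord 1 :> 'I_3 by apply: val_inj; rewrite /= inordK.
by have -> : lift ord0 (lift ord0 ord0) = inord 2 :> 'I_3 by apply: val_inj; rewrite /= inordK.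
Qed.

Lemma braketE psi M : let u := psi ord0 ord0 in let v := psi (lift ord0 ord0) ord0 in
  braket psi M = (conjc u * M ord0 ord0 + conjc v * M (lift ord0 ord0) ord0) * u +
    (conjc u * M ord0 (lift ord0 ord0) + conjc v * M (lift ord0 ord0) (lift ord0 ord0)) * v.
Proof.
by rewrite /braket !mxE !big_ord_recl !big_ord0 !addr0 !mxE !big_ord_recl !big_ord0 !addr0 !mxE.
Qed.

(** For amplitudes [u] and [v] these are twice the real and the imaginary part of [conjc u * v], and
    [|u|^2 - |v|^2]. *)
Definition bloch psi : 'cV[R]_3 :=
  let: (a +i* b)%C := psi ord0 ord0 in let: (c +i* d)%C := psi (lift ord0 ord0) ord0 in
  \col_i (if i == ord0 then 2 * (a * c + b * d)
          else if i == inord 1 then 2 * (a * d - b * c) else a ^+ 2 + b ^+ 2 - c ^+ 2 - d ^+ 2).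

Lemma half_complex : (2%:R)^-1 = ((2^-1 : R)%:C)%C :> R[i].
Proof. by rewrite fmorphV /= rmorph_nat. Qed.

Lemma bloch_unit psi : unit_state psi -> dot (bloch psi) (bloch psi) = 1.
Proof.
rewrite /unit_state braketE !mxE /= !mulr1 !mulr0 addr0 add0r dot3 /bloch /bx /by_ /bz.
case: (psi ord0 ord0) => a b; case: (psi (lift ord0 ord0) ord0) => c d.
rewrite !mxE eqxx.
have -> : (inord 1 == ord0 :> 'I_3) = false by rewrite -val_eqE /= inordK.
have -> : (inord 2 == ord0 :> 'I_3) = false by rewrite -val_eqE /= inordK.
have -> : (inord 2 == inord 1 :> 'I_3) = false by rewrite -val_eqE /= !inordK.
rewrite eqxx => -[h _].
have e : a ^+ 2 + b ^+ 2 + c ^+ 2 + d ^+ 2 = 1 by rewrite -h; ring.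
transitivity ((a ^+ 2 + b ^+ 2 + c ^+ 2 + d ^+ 2) ^+ 2); first by ring.
by rewrite e expr1n.
Qed.

Lemma born_proj_of psi a : unit_state psi ->
  born psi (proj_of a) = (1 + dot (bloch psi) a) / 2.
Proof.
rewrite /unit_state /born !braketE !mxE /= !mulr1 !mulr0 addr0 add0r dot3 /bloch /bx /by_ /bz.
rewrite half_complex.
case: (psi ord0 ord0) => p q; case: (psi (lift ord0 ord0) ord0) => c d.
rewrite !mxE eqxx.
have -> : (inord 1 == ord0 :> 'I_3) = false by rewrite -val_eqE /= inordK.
have -> : (inord 2 == ord0 :> 'I_3) = false by rewrite -val_eqE /= inordK.
have -> : (inord 2 == inord 1 :> 'I_3) = false by rewrite -val_eqE /= !inordK.
rewrite eqxx => -[h _].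
have e : p ^+ 2 + q ^+ 2 + c ^+ 2 + d ^+ 2 = 1 by rewrite -h; ring.
move: (a ord0 ord0) (a (inord 1) ord0) (a (inord 2) ord0) => x y z.
transitivity (((p ^+ 2 + q ^+ 2 + c ^+ 2 + d ^+ 2) + (2 * (p * c + q * d) * x
   + 2 * (p * d - q * c) * y + (p ^+ 2 + q ^+ 2 - c ^+ 2 - d ^+ 2) * z)) / 2).
  by rewrite /=; field.
by rewrite e.
Qed.

End Bloch.

(** * Expected loss and regret *)

Section FailureProbability.
Variables (R : realType) (k : nat) (eigf : 'M[R]_3 -> 'M[R]_3)
  (med : seq R -> R) (argsel : seq R -> nat) (theta0 : 'cV[R]_3) (psi : 'cV[R[i]]_2).
Hypothesis heig : forall V, V^T = V -> eig_spec V (eigf V).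
Hypothesis hmed : forall s : seq R, s != [::] -> is_median s (med s).
Hypothesis hargsel : forall s : seq R, s != [::] -> is_argmin s (argsel s).
Hypothesis k2 : (2 <= k)%N.
Hypothesis hpsi : unit_state psi.
Let theta := bloch psi.
Let theta1 : dot theta theta = 1 := bloch_unit hpsi.
Let k0 : (0 < k)%N := ltnW k2.
Let pol := linucb_policy 2 k eigf med argsel theta0.

Local Notation blk_mean := (block_mean k eigf med argsel theta0 theta).
Local Notation blk_act := (block_action k eigf med argsel theta0).
Local Notation good := (good_batch k eigf med argsel theta0 theta).
Local Notation potential := (potential k eigf med argsel theta0 theta).
Local Notation past_good := (past_good k eigf med argsel theta0 theta).
Local Notation bad_sample := (bad_sample k eigf med argsel theta0 theta).
Local Notation VV := (design_mx k eigf med argsel theta0).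
Local Notation that := (estimate k eigf med argsel theta0).

Lemma batch_actionE x s sg i :
  batch_action (n := 1) 2 k eigf med argsel theta0 x s.+1 sg i =
  action eigf (VV x s) (that x s) sg i.
Proof. by rewrite /batch_action /design_mx /estimate /bandit_state /=; case: lstate => [[V b] th]. Qed.

Lemma linucb_blochE t h :
  linucb_bloch (n := 1) 2 k eigf med argsel theta0 t h = blk_act (nth false h) (t %/ k)%N.
Proof.
have q : (t %/ batch_len 1 k = t %/ k %/ 4)%N.
  by rewrite /batch_len /= -divnMA mulnC.
have m : ((t %% batch_len 1 k) %/ k = (t %/ k) %% 4)%N.
  have lt4 : ((t %% (2 * 2 * k)) %/ k < 4)%N by rewrite ltn_divLR // ltn_mod muln_gt0.
  rewrite /batch_len /= [in RHS](divn_eq t (2 * 2 * k)) mulnA divnMDl // modnMDl.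
  by rewrite [RHS]modn_small.
by rewrite /linucb_bloch m /batch_of q batch_actionE.
Qed.

Lemma born_pol t h : born psi (pol t h) = (1 + blk_mean (nth false h) (t %/ k)%N) / 2.
Proof. by rewrite /pol /linucb_policy born_proj_of // linucb_blochE. Qed.

Lemma pol_valid t h : 0 <= born psi (pol t h) <= 1.
Proof.
rewrite born_pol; have := block_mean_bounds k med argsel theta0 heig (nth false h) theta1 (t %/ k).
by move=> /andP[m1 m2]; apply/andP; split; lra.
Qed.

Definition fail_at s x : bool :=
  past_good s x (4 * s) && (k <= 3 * count (bad_sample x s) (iota 0 k))%N.

Lemma fail_at_ext s x x' : agree (k * (4 * s)) x x' -> fail_at s x = fail_at s x'.
Proof.
move=> ag; have e0 := past_good_ext eigf med theta0 theta hargsel k0 s ag.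
have e : count (bad_sample x s) (iota 0 k) = count (bad_sample x' s) (iota 0 k).
  apply: eq_in_count => j; rewrite mem_iota => /= jk.
  rewrite /bad_sample (shifted_gram_ext eigf med theta0 hargsel k0 _ ag).
  by rewrite (noise_sum_ext eigf med theta0 theta hargsel k0 jk ag).
exact: (congr2 andb e0 (congr1 (fun c => (k <= 3 * c)%N) e)).
Qed.

Lemma agree_take h m : agree m (nth false h) (nth false (take m h)).
Proof. by move=> r rm; rewrite nth_take. Qed.

Lemma agree_rcons h b : agree (size h) (nth false h) (nth false (rcons h b)).
Proof. by move=> r rh; rewrite nth_rcons rh. Qed.

(** Markov's inequality: on [fail_at] the potential exceeds [expR (k / 24)] times its starting value
    [c], which is the same on every path and cancels. *)
Lemma fail_probability T s : (0 < s)%N -> (4 * k * s <= T)%N ->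
  Expect psi pol (fun x : {ffun 'I_T -> bool} => (fail_at s (nth false (codom x)))%:R)
  <= expR (- (k%:R / 24)).
Proof.
move=> s0 sT; pose f h := potential s (nth false h) (size h).
have step h : (size h < 4 * k * s)%N -> let p := born psi (pol (size h) h) in
    p * f (rcons h true) + (1 - p) * f (rcons h false) <= f h.
  move=> hs /=; rewrite born_pol /f !size_rcons.
  apply: potential_step => //; try exact: agree_rcons.
    by rewrite nth_rcons ltnn eqxx.
  by rewrite nth_rcons ltnn eqxx.
have := Expect_supermartingale pol_valid T step.
set c := potential s (nth false [::]) 0.
have pot0 x : potential s x 0 = expR (- ln (\det (reference_mx theta s)) / 384) ^+ k.
  exact: potential0.
have c0 : 0 < c by rewrite /c pot0; apply/exprn_gt0/expR_gt0.
rewrite [f [::]]/f /= -/c => hE.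
have e0 := expR_gt0 (k%:R / 24 : R).
rewrite expRN -(ler_pM2l (mulr_gt0 e0 c0)) -ExpectZ.
rewrite [leRHS]mulrAC mulfV ?gt_eqF // mul1r.
apply: le_trans hE; apply: Expect_le; first exact: pol_valid.
move=> x; set h := take _ _.
have sh : size h = (4 * k * s)%N by rewrite size_takel // size_codom_ord.
have -> : fail_at s (nth false (codom x)) = fail_at s (nth false h).
  by apply: fail_at_ext; rewrite mulnA [(k * 4)%N]mulnC; exact: agree_take.
rewrite /f sh; have [/andP[g1 g2]|_] := boolP (fail_at s (nth false h)).
  have := potential_final heig theta1 k0 s0 g1 g2.
  by rewrite mulr1 /c !pot0.
rewrite mulr0; apply: mulr_ge0; first by case: past_good.
by apply: prodr_ge0 => j _; exact: sample_energy_ge0.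
Qed.

(** Before the first bad batch all batches are good, so [good_step] can fail there only through the
    number of bad samples. *)
Lemma first_failure x s : (exists2 r, (0 < r <= s)%N & ~~ good x r) ->
  exists2 r, (0 < r <= s)%N & fail_at r x.
Proof.
move=> ex; have ex' : exists r, (0 < r <= s)%N && ~~ good x r.
  by case: ex => r h1 h2; exists r; rewrite h1.
case: (ex_minnP ex') => r /andP[h1 h2] hmin; exists r => //.
have /andP[r0 rs] := h1.
have hg r' : (0 < r' < r)%N -> good x r'.
  move=> /andP[r0' rr]; apply/negPn/negP => hb; have := hmin r'.
  by rewrite r0' hb (leq_trans (ltnW rr) rs) => /(_ isT); rewrite leqNgt rr.
rewrite /fail_at; apply/andP; split.
  apply/forallP => r'; apply/implyP => /andP[r0' _]; by apply: hg; rewrite r0' ltn_ord.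
rewrite leqNgt; apply: contra h2 => few.
exact: (good_step heig hmed hargsel theta1 r0 hg k2 few).
Qed.

End FailureProbability.

Section ExpectedLoss.
Variables (R : realType) (k : nat) (eigf : 'M[R]_3 -> 'M[R]_3)
  (med : seq R -> R) (argsel : seq R -> nat) (theta0 : 'cV[R]_3) (psi : 'cV[R[i]]_2).
Hypothesis heig : forall V, V^T = V -> eig_spec V (eigf V).
Hypothesis hmed : forall s : seq R, s != [::] -> is_median s (med s).
Hypothesis hargsel : forall s : seq R, s != [::] -> is_argmin s (argsel s).
Hypothesis k2 : (2 <= k)%N.
Hypothesis hpsi : unit_state psi.
Let theta := bloch psi.
Let theta1 : dot theta theta = 1 := bloch_unit hpsi.
Let k0 : (0 < k)%N := ltnW k2.
Let pol := linucb_policy 2 k eigf med argsel theta0.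

Local Notation blk_act := (block_action k eigf med argsel theta0).
Local Notation good := (good_batch k eigf med argsel theta0 theta).
Local Notation VV := (design_mx k eigf med argsel theta0).
Local Notation that := (estimate k eigf med argsel theta0).
Local Notation Lam := (sqrt_lam_max k eigf med argsel theta0).
Local Notation lmin := (lam_min k eigf med argsel theta0).
Local Notation hh := (sqrt_trace k eigf med argsel theta0).
Local Notation fail_at := (fail_at k eigf med argsel theta0 psi).

(** Large enough for [action_loss]: on late good batches it must exceed [61^2 * 49 / 8 / mu], about
    [22800 / mu], and it must exceed [s + 1] as long as [Lam <= small_scale]. *)
Definition rate : R := 30 * 1000 / mu R.

Lemma rate_ge1 : 1 <= rate.
Proof.
have m0 := mu_gt0 R; have := mu_le R; rewrite /rate ler_pdivlMr //; lra.
Qed.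

Lemma action_loss_le1 x s sg i : 1 - dot theta (action eigf (VV x s) (that x s) sg i) <= 2.
Proof.
have u : dot (action eigf (VV x s) (that x s) sg i) (action eigf (VV x s) (that x s) sg i) = 1.
  by apply: action_unit; [exact: design_eig|exact: lam_min_ge2].
have := cauchy_schwarz theta (action eigf (VV x s) (that x s) sg i).
rewrite theta1 u mulr1; move: (dot _ _) => d hd; nra.
Qed.

(** The loss never exceeds 1. An earlier or present failure pays for it by one indicator; while
    [Lam <= small_scale] the first term is at least 1; otherwise [good_regret] applies. *)
Lemma action_loss x s sg i :
  (1 - dot theta (action eigf (VV x s) (that x s) sg i)) / 2 <=
  rate / s.+1%:R + \sum_(1 <= r < s.+1) (fail_at r x)%:R.
Proof.
have m0 := mu_gt0 R; have m1 := mu_le R.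
have le1 := action_loss_le1 x s sg i.
have S0 : 0 <= \sum_(1 <= r < s.+1) (fail_at r x)%:R :> R by apply: sumr_ge0.
have n0 : 0 < s.+1%:R :> R by rewrite ltr0n.
have r1 := rate_ge1.
have small : s.+1%:R <= rate -> (1 - dot theta (action eigf (VV x s) (that x s) sg i)) / 2 <=
    rate / s.+1%:R + \sum_(1 <= r < s.+1) (fail_at r x)%:R.
  move=> h; have : 1 <= rate / s.+1%:R by rewrite ler_pdivlMr // mul1r.
  move: le1 S0; move: (dot _ _) (\sum_(_ <= _ < _) _) (rate / _) => d S q; lra.
case: (posnP s) => [s0|s0]; first by apply: small; rewrite s0.
have [/existsP[r /andP[r0 rb]]|hg] := boolP [exists r : 'I_s.+1, (0 < r)%N && ~~ good x r].
  have [|r' /andP[r0' rs'] hf] := @first_failure R k eigf med argsel theta0 psi heig hmed hargsel k2 hpsi x s.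
    by exists r => //; rewrite r0 /= -ltnS ltn_ord.
  have : 1 <= \sum_(1 <= r < s.+1) (fail_at r x)%:R :> R.
    rewrite (bigD1_seq r') ?iota_uniq ?mem_index_iota ?r0' //= hf lerDl.
    by apply: sumr_ge0.
  have : 0 <= rate / s.+1%:R by apply: divr_ge0; [apply: le_trans r1|exact: ltW].
  move: le1; move: (dot _ _) (\sum_(_ <= _ < _) _) (rate / _) => d S q; lra.
have gs : good x s.
  apply/negPn/negP => hb; move/negP: hg; apply; apply/existsP.
  by exists ord_max; rewrite /= s0.
have hs : 3 + mu R * s%:R <= hh x s.
  by have /andP[] := sqrt_trace_bounds k med argsel theta0 heig x s.-1; rewrite prednK.
have /andP[hL _] := sqrt_lam_max_trace k med argsel theta0 heig x s.
have e1 : s.+1%:R = s%:R + 1 :> R by rewrite natr1.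
have s1 : 1 <= s%:R :> R by rewrite ler1n.
have [Lq|Lq] := leP (Lam x s) (small_scale R).
  apply: small; rewrite /rate ler_pdivlMr // e1; move: Lq; rewrite /small_scale; lra.
have := good_regret heig theta1 sg i s0 gs Lq.
have lL := lam_min_ge_sqrt_max k med argsel theta0 heig x s0.
move: lL; move: (lmin x s) (Lam x s) (hh x s) hL hs => l L h hL hs lL.
have l0 : 0 < l by nra.
have lb : 8 / 49 * (mu R * s.+1%:R) <= l by rewrite e1; nra.
have e2 : 2 * (2 * 30 + 1) ^+ 2 / l <= 2 * (rate / s.+1%:R).
  rewrite ler_pdivrMr // /rate.
  have -> : 2 * (30 * 1000 / mu R / s.+1%:R) * l = 2 * (30 * 1000) * (l / (mu R * s.+1%:R)).
    by field; rewrite !gt_eqF.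
  have : 8 / 49 <= l / (mu R * s.+1%:R) by rewrite ler_pdivlMr // mulr_gt0.
  move: (l / _) => v; lra.
move: S0 e2; move: (dot _ _) (\sum_(_ <= _ < _) _) (rate / _) (_ / l) => d S q v; lra.
Qed.

Lemma expected_loss T s sg i : (4 * k * s <= T)%N ->
  Expect psi pol (fun x : {ffun 'I_T -> bool} =>
     1 - born psi (proj_of (batch_action (n := 1) 2 k eigf med argsel theta0 (nth false (codom x)) s.+1 sg i)))
  <= rate / s.+1%:R + s%:R * expR (- (k%:R / 24)).
Proof.
move=> sT.
apply: (@le_trans _ _ (Expect psi pol (fun x : {ffun 'I_T -> bool} =>
   rate / s.+1%:R + \sum_(1 <= r < s.+1) (fail_at r (nth false (codom x)))%:R))).
  apply: Expect_le; first exact: pol_valid.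
  move=> x; rewrite batch_actionE born_proj_of //.
  by apply: le_trans (action_loss (nth false (codom x)) s sg i); rewrite -/theta; lra.
rewrite ExpectD Expect_cst lerD2l Expect_sum.
apply: (@le_trans _ _ (\sum_(1 <= r < s.+1) expR (- (k%:R / 24)))).
  rewrite big_nat_cond [leRHS]big_nat_cond; apply: ler_sum => r /andP[/andP[r0 rs] _].
  by apply: fail_probability => //; apply: leq_trans sT; rewrite leq_mul2l -ltnS rs orbT.
by rewrite sumr_const_nat subn1 -[leLHS]mulr_natl.
Qed.

(** The policy sees the truncated history and [expected_loss] the whole reward sequence; the action
    of a block depends only on the rewards of earlier blocks. *)
Lemma round_loss T t : (t < T)%N ->
  Expect psi pol (fun x : {ffun 'I_T -> bool} => 1 - born psi (pol t (hist x t))) =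
  Expect psi pol (fun x : {ffun 'I_T -> bool} =>
     1 - born psi (proj_of (batch_action (n := 1) 2 k eigf med argsel theta0 (nth false (codom x))
       (t %/ k %/ 4).+1 (((t %/ k) %% 4) %% 2 == 0)%N (inord (((t %/ k) %% 4) %/ 2))))).
Proof.
move=> tT; rewrite /Expect; apply: eq_bigr => x _.
have ag : agree (k * (t %/ k)) (nth false (codom x)) (nth false (hist x t)).
  apply: (@agree_le t); first by rewrite mulnC leq_divM.
  exact: agree_take.
have e : pol t (hist x t) = proj_of (blk_act (nth false (codom x)) (t %/ k)%N).
  have [-> _] := block_ext eigf med theta0 hargsel k0 ag.
  by rewrite /pol /linucb_policy linucb_blochE.
by rewrite e batch_actionE.
Qed.

End ExpectedLoss.

(** * Logarithms and the choice of the horizon *)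

Section Logarithms.
Variable R : realType.

Lemma harmonic_le n : \sum_(t < n.+1) (t.+1%:R)^-1 <= 1 + ln n.+1%:R :> R.
Proof.
elim: n => [|n IH]; first by rewrite big_ord_recl big_ord0 invr1 addr0 ln1 addr0.
rewrite big_ord_recr /=; apply: le_trans (lerD IH (lexx _)) _.
have n0 : 0 < n.+1%:R :> R by rewrite ltr0n.
(* At [y = 1 / (n + 1)] the fraction [y / (1 + y)] is the new term [1 / (n + 2)]. *)
have := @ln1D_ge R (n.+1%:R^-1); rewrite invr_ge0 ler0n => /(_ isT).
have -> : 1 + n.+1%:R^-1 = n.+2%:R / n.+1%:R :> R by rewrite -[n.+2%:R]natr1; field; rewrite gt_eqF.
rewrite ln_div ?posrE ?ltr0n //.
have -> : n.+1%:R^-1 / (n.+2%:R / n.+1%:R) = n.+2%:R^-1 :> R.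
  have aux (a b : R) : 0 < a -> 0 < b -> a^-1 / (b / a) = b^-1.
    by move=> a0 b0; field; rewrite !gt_eqF.
  by rewrite aux ?ltr0n.
by move: (ln n.+1%:R) (ln n.+2%:R) (n.+2%:R^-1) => a b c; lra.
Qed.

Lemma ln2_ge : 1 / 2 <= ln 2 :> R.
Proof.
rewrite -[X in X <= _](expRK (1 / 2)) ler_ln ?posrE ?expR_gt0 //.
by apply: le_trans (exp_half_le R) _; lra.
Qed.

End Logarithms.

Lemma batch_of_div k t : batch_of 1 k t = (t %/ k %/ 4).+1.
Proof. by rewrite /batch_of /batch_len /= -divnMA mulnC. Qed.

Section Horizon.
Variables (R : realType) (Tt : nat).
Hypothesis Tt2 : (2 <= Tt)%N.
Let k : nat := absz (Num.ceil (24%:R * ln ((Tt ^ 2)%:R : R))).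
Let T : nat := (4 * k * Tt)%N.

Lemma ln_sqr_horizon : ln (Tt ^ 2)%:R = 2 * ln Tt%:R :> R.
Proof. by rewrite natrX lnXn ?ltr0n ?(ltnW Tt2) // mulr_natl. Qed.

Lemma ln_batches_ge : 1 / 2 <= ln Tt%:R :> R.
Proof.
apply: le_trans (ln2_ge R) _; rewrite ler_ln ?posrE ?ltr0n ?(ltnW Tt2) //.
by rewrite ler_nat.
Qed.

Lemma samples_bounds : (48 * ln Tt%:R <= k%:R :> R) /\ (k%:R <= 48 * ln Tt%:R + 1 :> R).
Proof.
have h := ln_batches_ge; have e := ln_sqr_horizon.
set z := 24%:R * ln ((Tt ^ 2)%:R : R).
have zE : z = 48 * ln Tt%:R by rewrite /z e; ring.
have z0 : 0 <= z by rewrite zE; lra.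
have kE : k%:R = (Num.ceil z)%:~R :> R.
  rewrite /k -/z natr_absz ger0_norm // ceil_ge0; apply: lt_le_trans z0; lra.
have /andP[c1 c2] := ceil_itv z; rewrite kE -zE; split=> //.
by move: c1; rewrite intrB ltrBlDr => /ltW.
Qed.

Lemma samples_ge2 : (2 <= k)%N.
Proof.
have [h _] := samples_bounds; have h0 := ln_batches_ge.
by rewrite -(ler_nat R); lra.
Qed.

Lemma batches_le_horizon : (Tt <= T)%N.
Proof. by rewrite /T leq_pmull // muln_gt0 /= (ltnW samples_ge2). Qed.

Lemma ln_horizon_ge : ln Tt%:R <= ln T%:R :> R.
Proof.
have T0 := leq_trans (ltnW Tt2) batches_le_horizon.
by rewrite ler_ln ?posrE ?ltr0n ?(ltnW Tt2) // ler_nat batches_le_horizon.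
Qed.

Lemma samples_le : k%:R <= 50 * ln T%:R :> R.
Proof.
have [_ h] := samples_bounds; have h0 := ln_batches_ge; have h1 := ln_horizon_ge.
by apply: le_trans h _; lra.
Qed.

Lemma failure_le : expR (- (k%:R / 24)) <= (Tt%:R ^+ 2)^-1 :> R.
Proof.
have [h _] := samples_bounds.
have T0 : 0 < Tt%:R :> R by rewrite ltr0n ltnW.
rewrite -natrX -[leRHS]lnK ?posrE ?invr_gt0 ?natrX ?exprn_gt0 // ler_expR.
by rewrite lnV ?posrE ?exprn_gt0 // -natrX ln_sqr_horizon lerN2; lra.
Qed.

(** The failure term is at most [Tt / Tt^2], hence at most [1 / (s + 1)], and raises [c] to [c + 1].
    A batch has [4 * k] rounds and [k <= 50 * ln T], whence 200. *)
Lemma loss_rate t (c : R) : (t < T)%N -> 0 <= c ->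
  c / (t %/ k %/ 4).+1%:R + (t %/ k %/ 4)%:R * expR (- (k%:R / 24)) <=
  200 * (c + 1) * ln T%:R / t.+1%:R.
Proof.
move=> tT c0; set s := (t %/ k %/ 4)%N.
have k0 := ltnW samples_ge2.
have sT : (s < Tt)%N.
  by rewrite /s -divnMA ltn_divLR ?muln_gt0 ?k0 // mulnC [(k * 4)%N]mulnC.
have ts : (t.+1 <= 4 * k * s.+1)%N.
  by rewrite [(4 * k)%N]mulnC mulnC /s -divnMA ltn_ceil // muln_gt0 k0.
have s0 : 0 < s.+1%:R :> R by rewrite ltr0n.
have T0 : 0 < Tt%:R :> R by rewrite ltr0n ltnW.
have t0 : 0 < t.+1%:R :> R by rewrite ltr0n.
have e1 : s%:R * expR (- (k%:R / 24)) <= s.+1%:R^-1 :> R.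
  apply: (@le_trans _ _ (Tt%:R^-1 : R)); last first.
    by rewrite lef_pV2 ?posrE // ler_nat.
  apply: (@le_trans _ _ (Tt%:R * (Tt%:R ^+ 2)^-1)).
    by apply: ler_pM => //; [by rewrite ler_nat ltnW|exact: failure_le].
  by rewrite expr2 invfM mulrA mulfV ?gt_eqF // mul1r.
have e2 : s.+1%:R^-1 <= 4 * k%:R / t.+1%:R :> R.
  rewrite ler_pdivlMr // ler_pdivrMl // mulrC -!natrM ler_nat.
  exact: ts.
have e3 := samples_le.
apply: (@le_trans _ _ ((c + 1) * (s.+1%:R^-1))).
  by rewrite [leRHS]mulrDl mul1r lerD2l.
apply: (@le_trans _ _ ((c + 1) * (4 * k%:R / t.+1%:R))).
  by rewrite ler_wpM2l // addr_ge0.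
rewrite !mulrA ler_pM2r ?invr_gt0 //.
have := ler_wpM2l (addr_ge0 c0 ler01) e3.
by move: k%:R (ln _) => a b; lra.
Qed.

End Horizon.

Theorem mainTheorem1 (R : realType) :
  exists C1 C2 C3 : R, 0 <= C1 /\ 0 <= C2 /\ 0 <= C3 /\
  forall Tt : nat, (2 <= Tt)%N ->
  let k : nat := absz (Num.ceil (24%:R * ln ((Tt ^ 2)%:R : R))) in
  let T : nat := (4 * k * Tt)%N in
  forall psi : 'cV[R[i]]_2, unit_state psi ->
  forall eigf : 'M[R]_3 -> 'M[R]_3,
    (forall V : 'M[R]_3, V^T = V -> eig_spec V (eigf V)) ->
  forall med : seq R -> R,
    (forall s : seq R, s != [::] -> is_median s (med s)) ->
  forall argsel : seq R -> nat,
    (forall s : seq R, s != [::] -> is_argmin s (argsel s)) ->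
  forall theta0 : 'cV[R]_3, vnorm theta0 = 1 ->
  let pol := linucb_policy 2 k eigf med argsel theta0 in
  Expect psi pol (@regret R psi pol T)
    <= C1 * ln (T%:R : R) + C2 * ln (T%:R : R) ^+ 2
  /\
  forall t : nat, (1 <= t <= T)%N ->
  forall (sg : bool) (i : 'I_2),
    Expect psi pol
      (fun x : {ffun 'I_T -> bool} =>
         1 - born psi (proj_of (batch_action 2 k eigf med argsel theta0
                 (nth false (codom x)) (@batch_of 1 k t.-1) sg i)))
    <= C3 * ln (T%:R : R) / t%:R.
Proof.
have r1 := rate_ge1 R; have r0 : 0 <= rate R by apply: le_trans r1.
pose C : R := 200 * (rate R + 1).
have C0 : 0 <= C by rewrite /C mulr_ge0 // addr_ge0.
(* One constant suffices: summing [C * ln T / t] against the harmonic bound [1 + ln T] gives [C] in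
   both terms of the regret. *)
exists C, C, C; do 3 split=> //.
move=> Tt Tt2 k T psi hpsi eigf heig med hmed argsel hargsel theta0 _ pol.
have k2 : (2 <= k)%N := samples_ge2 R Tt2.
have loss t sg i : (t < T)%N -> Expect psi pol (fun x : {ffun 'I_T -> bool} =>
    1 - born psi (proj_of (batch_action (n := 1) 2 k eigf med argsel theta0
      (nth false (codom x)) (t %/ k %/ 4).+1 sg i))) <= C * ln T%:R / t.+1%:R.
  move=> tT; apply: le_trans (loss_rate Tt2 tT r0).
  apply: expected_loss => //.
  apply: leq_trans (ltnW tT).
  by rewrite mulnC [(4 * k)%N]mulnC -divnMA leq_divM.
split; last first.
  move=> [//|t] /andP[_ tT] sg i; rewrite batch_of_div.
  exact: loss.
have -> : Expect psi pol (@regret R psi pol T) =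
    \sum_(t < T) Expect psi pol (fun x : {ffun 'I_T -> bool} => 1 - born psi (pol t (hist x t))).
  exact: Expect_sum.
apply: (@le_trans _ _ (\sum_(t < T) C * ln T%:R / t.+1%:R)).
  apply: ler_sum => t _; rewrite round_loss //; exact: loss.
rewrite -mulr_sumr.
have T0 : (0 < T)%N by apply: leq_trans (batches_le_horizon R Tt2); exact: ltnW.
have lnT0 : 0 <= ln T%:R :> R by apply: ln_ge0; rewrite ler1n.
have h := harmonic_le R T.-1; rewrite prednK // in h.
apply: le_trans (ler_wpM2l (mulr_ge0 C0 lnT0) h) _.
by rewrite mulrDr mulr1 expr2 mulrA.
Qed.
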